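(* Let $G$ be a connected duality admissible graph with $h_G,n_G\ge3$. Then the $c_2$ invariants of $G$ in parametric space, momentum space, dual parametric space and position space all coincide: for every prime power $q$, $$c_2(G)_q=c_2^{\mathrm{mom}}(G)_q=c_2^{\mathrm{dual}}(G)_q=c_2^{\mathrm{pos}}(G)_q\quad\text{in }\mathbb{Z}/q\mathbb{Z}.$$
   Context: Graphs are finite and may have multiple edges and self-loops. For a graph $G$ let $N_G$ be its number of edges $e_1,\dots,e_{N_G}$, $n_G=|V(G)|-1$, and $h_G=N_G-n_G$. $G$ is log-divergent if $N_G=2h_G$ (equivalently $N_G=2n_G$). Graph polynomial and dual graph polynomial: $\Psi_G=\sum_T\prod_{e\notin T}\alpha_e$ and $\varphi_G=\sum_T\prod_{e\in T}\alpha_e$ in $\mathbb{Z}[\alpha_1,\dots,\alpha_{N_G}]$, the sums running over spanning trees $T$ of $G$. For a polynomial $f\in\mathbb{Z}[a_1,\dots,a_N]$ and a prime power $q$, $[f]_q$ denotes the number of zeros of $f$ (reduced to $\mathbb{F}_q$) in $\mathbb{F}_q^N$. Parametric space: if $n_G\ge2$ then $q^2\mid[\Psi_G]_q$ and $c_2(G)_q:=[\Psi_G]_q/q^2\bmod q$. Dual parametric space: if $h_G\ge2$ then $q^2\mid[\varphi_G]_q$ and $c_2^{\mathrm{dual}}(G)_q:=[\varphi_G]_q/q^2\bmod q$. Here $\Psi_G,\varphi_G$ are regarded as polynomials in all $N_G$ variables. Write $|x|^2=x^1x^2+x^3x^4$ for a 4-vector $x=(x^1,x^2,x^3,x^4)$.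 Position space: put $n=n_G$. Label the vertices $1,\dots,n+1$, attach to vertex $p$ a 4-vector variable $x_p$ for $1\le p\le n$, and set $x_{n+1}=0$. For an edge $e_i$ with endpoints $s,t$ let $q_i(x)=|x_s-x_t|^2$, a polynomial in the $4n$ coordinates $x_p^j$. If $N_G\le2n_G$, $n_G\ge2$, then $q^2\mid[q_1\cdots q_{N_G}]_q$ (zeros of the product counted in $\mathbb{F}_q^{4n}$) and $c_2^{\mathrm{pos}}(G)_q:=[q_1\cdots q_{N_G}]_q/q^2\bmod q$. Momentum space ($G$ connected): orient the edges and choose a $\mathbb{Z}$-basis $\gamma_1,\dots,\gamma_{h}$ of $H_1(G,\mathbb{Z})\subset\mathbb{Z}^{E(G)}$, $h=h_G$; attach to $\gamma_j$ a 4-vector variable $k_j$. For an edge $e_i$ let $Q_i(k)=\big|\sum_{j=1}^{h}\gamma_{j,i}k_j\big|^2$, where $\gamma_{j,i}$ is the coefficient of $e_i$ in $\gamma_j$; this is a polynomial in $4h$ variables. If $N_G\le2h_G$, $h_G\ge2$, then $q^2\mid[Q_1\cdots Q_{N_G}]_q$ (zeros of the product counted in $\mathbb{F}_q^{4h}$) and $c_2^{\mathrm{mom}}(G)_q:=[Q_1\cdots Q_{N_G}]_q/q^2\bmod q$. For disjoint $I,J\subset\{1,\dots,N_G\}$ let $\varphi^J_{I}$ be the polynomial in the $N_G-|I|-|J|$ variables $\alpha_k$, $k\notin I\cup J$, obtained from $\varphi_G$ by taking the coefficient of $\prod_{j\in J}\alpha_j$ and setting $\alpha_i=0$ for $i\in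 I$; i.e. $\varphi^J_I=\sum_{T\supset J,\,T\cap I=\emptyset}\prod_{e\in T\setminus J}\alpha_e$. A log-divergent graph $G$ with $h_G,n_G\ge3$ is called duality admissible if for every prime power $q$ one has $[\varphi^J_I]_q\equiv0\bmod q^3$ (zeros counted in $\mathbb{F}_q^{N_G-|I|-|J|}$) for all disjoint $I,J\subset\{1,\dots,N_G\}$ with $|I|<|J|\le n_G$ and $0\le|I|\le n_G-3$. *)

(* Defs.v *)
From HB Require Import structures.
From mathcomp Require Import all_boot all_order all_algebra.
From mathcomp Require Import mpoly.

Set Implicit Arguments.
Unset Strict Implicit.
Unset Printing Implicit Defensive.

Import GRing.Theory.
Local Open Scope ring_scope.

(* Finite multigraphs with self-loops.  The vertex set is {0, ..., nG}, so that
   nG = |V| - 1, and the edge set is {0, ..., NG - 1}.  An edge is given with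
   an order of its two ends; this order is the orientation used to define H_1
   and plays no role elsewhere. *)
Record graph := Graph {
  nG : nat;
  NG : nat;
  src : 'I_NG -> 'I_nG.+1;
  tgt : 'I_NG -> 'I_nG.+1 }.

(* Truncated subtraction, which is harmless for connected graphs. *)
Definition hG (G : graph) : nat := (NG G - nG G)%N.

Definition log_divergent (G : graph) : Prop := NG G = (2 * hG G)%N.

Section SpanningTrees.
Variable G : graph.
Implicit Types T : {set 'I_(NG G)}.

Definition adj T : rel 'I_(nG G).+1 :=
  fun u v => [exists e in T, ((src e == u) && (tgt e == v))
                          || ((src e == v) && (tgt e == u))].

Definition connected_by T : bool := [forall u, forall v, connect (adj T) u v].

(* A cycle consists of an edge e and of a path that joins the two ends of e and
   does not use e; a self-loop is a cycle since connect is reflexive. *)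
Definition acyclic T : bool :=
  [forall e in T, ~~ connect (adj (T :\ e)) (src e) (tgt e)].

Definition spanning_tree T : bool := connected_by T && acyclic T.

End SpanningTrees.

Definition connected_graph (G : graph) : Prop := connected_by [set: 'I_(NG G)].

Definition Psi (G : graph) : {mpoly int[NG G]} :=
  \sum_(T : {set 'I_(NG G)} | spanning_tree T) \prod_(e in ~: T) 'X_e.

Definition phi (G : graph) : {mpoly int[NG G]} :=
  \sum_(T : {set 'I_(NG G)} | spanning_tree T) \prod_(e in T) 'X_e.

(* phi^J_I for disjoint I and J, in the variables alpha_k with k outside of
   I :|: J: the variable 'X_i stands for alpha_k with k = enum_val i. *)
Definition phiIJ (G : graph) (I J : {set 'I_(NG G)}) :
    {mpoly int[#|~: (I :|: J)|]} :=
  \sum_(T : {set 'I_(NG G)} |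
        [&& spanning_tree T, J \subset T & [disjoint T & I]])
    \prod_(i < #|~: (I :|: J)| | enum_val i \in T :\: J) 'X_i.

Definition nzeros (m : nat) (f : {mpoly int[m]}) (F : finFieldType) : nat :=
  #|[set a : {ffun 'I_m -> F} | (map_mpoly intr f).@[a] == 0]|.

(* [f]_q / q^2 mod q for q = #|F|; the type 'Z_q is Z/qZ because q > 1. *)
Definition c2_of (m : nat) (f : {mpoly int[m]}) (F : finFieldType) : 'Z_#|F| :=
  (nzeros f F %/ #|F| ^ 2)%N%:R.

Definition norm4 (R : comNzRingType) (x : 'rV[R]_4) : R :=
  x 0 (inord 0) * x 0 (inord 1) + x 0 (inord 2) * x 0 (inord 3).

(* The p-th of m generic 4-vectors; the 4 m coordinates are numbered by
   mxvec_index. *)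
Definition vec4 (m : nat) (p : 'I_m) : 'rV[{mpoly int[m * 4]}]_4 :=
  \row_(j < 4) 'X_(mxvec_index p j).

(* The vertex ord_max is the one at the origin. *)
Definition xvec (G : graph) (v : 'I_(nG G).+1) : 'rV[{mpoly int[nG G * 4]}]_4 :=
  if unlift ord_max v is Some p then vec4 p else 0.

Definition pos_q (G : graph) (e : 'I_(NG G)) : {mpoly int[nG G * 4]} :=
  norm4 (xvec (src e) - xvec (tgt e)).

Definition boundary (G : graph) : 'M[int]_(NG G, (nG G).+1) :=
  \matrix_(e, v) ((v == tgt e)%:R - (v == src e)%:R).

(* The rows of gamma form a Z-basis of H_1(G, Z), the kernel of the boundary
   map Z^E -> Z^V. *)
Definition H1_basis (G : graph) (gamma : 'M[int]_(hG G, NG G)) : Prop :=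
  gamma *m boundary G = 0 /\
  forall c : 'rV[int]_(NG G), c *m boundary G = 0 ->
    exists! a : 'rV[int]_(hG G), c = a *m gamma.

Definition mom_Q (G : graph) (gamma : 'M[int]_(hG G, NG G)) (e : 'I_(NG G)) :
    {mpoly int[hG G * 4]} :=
  norm4 (\sum_(j < hG G) vec4 j *~ gamma j e).

Definition c2 (G : graph) (F : finFieldType) : 'Z_#|F| := c2_of (Psi G) F.

Definition c2_dual (G : graph) (F : finFieldType) : 'Z_#|F| := c2_of (phi G) F.

Definition c2_pos (G : graph) (F : finFieldType) : 'Z_#|F| :=
  c2_of (\prod_(e < NG G) pos_q e) F.

Definition c2_mom (G : graph) (gamma : 'M[int]_(hG G, NG G))
    (F : finFieldType) : 'Z_#|F| :=
  c2_of (\prod_(e < NG G) mom_Q gamma e) F.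

Definition duality_admissible (G : graph) : Prop :=
  [/\ log_divergent G, (3 <= hG G)%N, (3 <= nG G)%N &
   forall (F : finFieldType) (I J : {set 'I_(NG G)}),
     [disjoint I & J] -> (#|I| < #|J|)%N -> (#|J| <= nG G)%N ->
     (#|I| <= nG G - 3)%N ->
     (#|F| ^ 3 %| nzeros (phiIJ I J) F)%N].

(* Main.v *)
Require Import Defs.
From HB Require Import structures.
From mathcomp Require Import all_boot all_order all_algebra.
From mathcomp Require Import fingroup perm mxabelem zify ring.
From mathcomp Require Import mpoly.

Set Implicit Arguments.
Unset Strict Implicit.
Unset Printing Implicit Defensive.

Import GRing.Theory.
Local Open Scope ring_scope.

(** Both graph polynomials are determinants of a diagonal pencil A diag(alpha) A^T,
    with A the reduced incidence matrix for phi and the matrix gamma of a cycle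
    basis for Psi (Cauchy-Binet, and the squared maximal minors are 0 or 1), and
    the rows of the two matrices span orthogonal complements U and W of F^E.

    Quadrics versus determinant: for fixed (x1, x3) the equations
    x1_e x2_e + x3_e x4_e = 0, e in S, are linear in (x2, x4), and transposing this
    system turns the number of common zeros into
    q^(2n - |S|) sum_alpha q^(2 corank alpha), alpha supported on S. By
    inclusion-exclusion only S = E contributes modulo q^3.

    Psi versus phi: let every alpha_e range over the projective line instead, and
    let Y be the number of points at which the pencil is nondegenerate. The
    numbers of nonzeros of phi and of Psi are alternating sums of counts Y_J with
    the alpha_e, e in J, fixed at infinity, respectively at 0. Counting quadruples
    (y, y', z, z') in U^2 x W^2 with y_e z'_e = y'_e z_e for all e gives
    Y_J = 0 mod q^3 for J nonempty: these equations add up to a trivial identity,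
    and the transvections y' -> y' + t y provide one more factor q. Hence both
    numbers are congruent to Y, which is symmetric in U and W. *)

(** * Inclusion-exclusion and divisibility of moments *)

Lemma natb_forall (T : finType) (P : pred T) :
  ([forall e, P e] : nat) = (\prod_e (P e : nat))%N.
Proof.
case: forallP => [allP|/forallP]; first by rewrite big1 // => e _; rewrite allP.
by rewrite negb_forall => /existsP[e /negPf nPe]; rewrite (bigD1 e) //= nPe.
Qed.

Lemma dvdn_dvdz (d m : nat) : (d %| m)%N = (d%:Z %| m%:Z)%Z.
Proof. by rewrite dvdzE. Qed.

Lemma eqn_mod_dvdz (d a b : nat) : (a == b %[mod d]) = (d %| a%:Z - b%:Z)%Z.
Proof. by rewrite -eqz_mod_dvd !modz_nat. Qed.

(** Pointwise this is the expansion of prod_e (1 - P e x) over the subsets of [T]. *)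
Lemma inclusion_exclusion (X T : finType) (Q : pred X) (P : T -> pred X) :
  (#|[set x | Q x & [forall e, ~~ P e x]]|)%:Z =
  \sum_(S : {set T}) (-1) ^+ #|S| *
     (#|[set x | Q x & [forall e in S, P e x]]|)%:Z.
Proof.
have cardE (R : pred X) :
    (#|[set x | Q x & R x]|)%:Z = \sum_(x | Q x) (R x : nat)%:Z.
  rewrite -sum1_card (eq_bigl (fun x => Q x && R x)); last first.
    by move=> x; rewrite inE.
  by rewrite big_mkcondr /= -(big_morph Posz PoszD (erefl _)).
rewrite cardE.
under [RHS]eq_bigr => S _ do rewrite cardE mulr_sumr.
rewrite exchange_big /=; apply: eq_bigr => x _.
rewrite natb_forall (big_morph Posz PoszM (erefl _)).
transitivity (\prod_(e : T) (- (P e x : nat)%:Z + 1)).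
  by apply: eq_bigr => e _; case: (P e x).
rewrite bigA_distr; apply: eq_bigr => S _.
rewrite -big_mkcond /= (eq_bigr (fun e => (-1) * (P e x : nat)%:Z)); last first.
  by move=> e _; rewrite mulN1r.
rewrite big_split /= prodr_const; congr (_ * _).
rewrite natb_forall big_mkcond /= (big_morph Posz PoszM (erefl _)).
by apply: eq_bigr => e _; case: (e \in S).
Qed.

Lemma dvdn2_powers (p D C m S : nat) :
  S = (D + p ^ 2 * C + p ^ 3 * m)%N -> (p ^ 2 %| S)%N = (p ^ 2 %| D)%N.
Proof.
move=> ->; rewrite dvdn_addl; last by rewrite dvdn_mulr // dvdn_exp2l.
by rewrite dvdn_addl // dvdn_mulr.
Qed.

(** Meant for the first and second moments in [sum_powers]. The second moment gives p^2 | D, then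
    the first gives p | C, so that the term p^2 C of the second one disappears modulo p^3. *)
Lemma dvdn3_powers (p D C m1 m2 S1 S2 : nat) :
  S1 = (D + p * C + p ^ 2 * m1)%N -> S2 = (D + p ^ 2 * C + p ^ 3 * m2)%N ->
  (0 < p)%N -> (p ^ 2 %| S1)%N -> (p ^ 3 %| S2)%N -> (p ^ 3 %| D)%N.
Proof.
move=> E1 E2 p0 d1 d2.
have D2 : (p ^ 2 %| D)%N.
  by rewrite -(dvdn2_powers E2); apply: dvdn_trans d2; apply: dvdn_exp2l.
have pC : (p %| C)%N.
  move: d1; rewrite E1 dvdn_addl; last by rewrite dvdn_mulr.
  by rewrite dvdn_addr // expnS expn1 dvdn_pmul2l.
move: d2; rewrite E2 dvdn_addl; last by rewrite dvdn_mulr.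
by rewrite dvdn_addl // (expnSr p 2) dvdn_mul.
Qed.

(** * Counting solutions of linear systems over a finite field *)

Section LinearCounting.
Variable F : finFieldType.
Local Notation q := #|F|.

Lemma card_ker (m p : nat) (M : 'M[F]_(m, p)) :
  #|[set x : 'rV_m | x *m M == 0]| = (q ^ (m - \rank M))%N.
Proof.
rewrite -mxrank_ker -card_rowg; apply: eq_card => x.
by rewrite [RHS]mem_rowg inE; apply/eqP/sub_kermxP.
Qed.

(** Both sides are [q ^ (m + p - \rank M)]. *)
Lemma card_ker_tr (m p : nat) (M : 'M[F]_(m, p)) :
  (#|[set x : 'rV_m | x *m M == 0%R]| * q ^ p =
   #|[set x : 'rV_p | x *m M^T == 0%R]| * q ^ m)%N.
Proof.
rewrite !card_ker mxrank_tr -!expnD; congr (_ ^ _)%N.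
have := rank_leq_row M; have := rank_leq_col M; lia.
Qed.

Lemma dvdn_solutions (p : nat) (s : seq 'cV[F]_p) :
  (q ^ (p - size s) %| #|[set x : 'rV_p | all (fun c => x *m c == 0%R) s]|)%N.
Proof.
pose M := \matrix_(i < p, j < size s) s`_j i 0.
rewrite (_ : [set x | _] = [set x : 'rV_p | x *m M == 0]); last first.
  apply/setP => x; rewrite !inE; apply/(all_nthP 0)/eqP => [sx0|xM0 j ltj].
    apply/rowP => j; have /eqP/rowP/(_ 0) := sx0 j (ltn_ord j).
    by rewrite !mxE => E; rewrite -[RHS]E; apply: eq_bigr => i _; rewrite mxE.
  apply/eqP/rowP => i; rewrite ord1 {i}.
  have /rowP/(_ (Ordinal ltj)) := xM0.
  by rewrite !mxE => E; rewrite -[RHS]E; apply: eq_bigr => i _; rewrite mxE.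
by rewrite card_ker dvdn_exp2l // leq_sub2l // rank_leq_col.
Qed.

Lemma mulmxDZl_entry (m p : nat) (M : 'M[F]_(m, p)) (x y : 'rV_m) t e :
  ((y + t *: x) *m M) 0 e = (y *m M) 0 e + t * (x *m M) 0 e.
Proof. by rewrite mulmxDl -scalemxAl !mxE. Qed.

Definition vanish (m p : nat) (M : 'M[F]_(m, p)) (X : {set 'I_p}) (u : 'rV_m) :=
  [forall e in X, (u *m M) 0 e == 0].

Lemma mul_col_eq0 (m p : nat) (M : 'M[F]_(m, p)) (u : 'rV_m) (e : 'I_p) :
  (u *m col e M == 0) = ((u *m M) 0 e == 0).
Proof.
have E : (u *m M) 0 e = (u *m col e M) 0 0.
  by rewrite !mxE; apply: eq_bigr => i _; rewrite mxE.
rewrite E; apply/eqP/eqP => [->|uM0]; first by rewrite mxE.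
by apply/rowP => i; rewrite ord1 uM0 mxE.
Qed.

Lemma vanish_all (m p : nat) (M : 'M[F]_(m, p)) (X : {set 'I_p}) (u : 'rV_m) :
  vanish M X u = all (fun c => u *m c == 0) [seq col e M | e <- enum X].
Proof.
rewrite all_map; apply/forallP/allP => [vX e|vX e].
  by rewrite mem_enum /= mul_col_eq0; have := vX e; case: (e \in X).
by apply/implyP => Xe; rewrite -mul_col_eq0; apply: vX; rewrite mem_enum.
Qed.

Lemma dvdn_vanish (m p : nat) (M : 'M[F]_(m, p)) (X : {set 'I_p}) :
  (q ^ (m - #|X|) %| \sum_u vanish M X u)%N.
Proof.
have := dvdn_solutions [seq col e M | e <- enum X]; rewrite size_map -cardE.
rewrite -[#|finset _|]sum1_card [X in (_ %| X)%N -> _]big_mkcond /=.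
by rewrite (eq_bigr (fun u => vanish M X u : nat)) // => u _; rewrite inE vanish_all.
Qed.

(** Each line in the direction [u] meets the hyperplane x_i = 0 in exactly one point, and [g] is
    constant on it. *)
Lemma sum_transvection (m : nat) (g : 'rV[F]_m -> nat) (u : 'rV_m) (i : 'I_m) :
  u 0 i != 0 -> (forall t x, g (x + t *: u) = g x) ->
  (\sum_x g x = q * \sum_(x : 'rV[F]_m | x 0%R i == 0%R) g x)%N.
Proof.
move=> ui0 gu; rewrite -sum_nat_const.
rewrite (eq_bigr (fun t : F => \sum_(x : 'rV[F]_m | (x + t *: u)%R 0%R i == 0%R) g
  x))%N; last first.
  move=> t _; rewrite (reindex_inj (addIr (t *: u))) /=.
  by apply: eq_bigr => x _; rewrite gu.
rewrite (exchange_big_dep xpredT) //=; apply: eq_bigr => x _.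
rewrite (big_pred1 (- x 0 i / u 0 i)) // => t /=.
by rewrite !mxE addrC addr_eq0 -[RHS](inj_eq (mulIf ui0)) mulfVK.
Qed.

(* A number of the form [q ^ c] is either [1], [q], or divisible by [q ^ 2]. *)
Lemma sum_powers (X : finType) (P : pred X) (k : X -> nat) :
  (forall x, exists c, k x = q ^ c)%N ->
  exists C m1 m2,
    (\sum_(x | P x) k x = \sum_(x | P x) (k x == 1) + q * C + q ^ 2 * m1)%N /\
    (\sum_(x | P x) k x ^ 2 =
       \sum_(x | P x) (k x == 1) + q ^ 2 * C + q ^ 3 * m2)%N.
Proof.
move=> kE; have q1 : (1 < q)%N := card_finNzRing_gt1 F.
(* The remainder [r x] is 0 if [k x] is 1 or [q]; otherwise it is [k x], a multiple of [q ^ 2]. *)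
pose r x := (k x - (k x == 1) - q * (k x == q))%N.
exists (\sum_(x | P x) (k x == q))%N, (\sum_(x | P x) (r x %/ q ^ 2))%N.
exists (\sum_(x | P x) (r x %/ q ^ 2 * r x %/ q))%N.
have q0 := ltnW q1.
rewrite !big_distrr -!big_split /=; split; apply: eq_bigr => x _; rewrite /r.
  have [[|[|c]] ->] := kE x.
  - by rewrite expn0 eqxx (ltn_eqF q1) !muln0 subn0 subnn div0n muln0 !addn0.
  - by rewrite expn1 eqxx (gtn_eqF q1) !muln1 subn0 subnn div0n muln0 !addn0.
  have -> : (q ^ c.+2 == 1)%N = false by rewrite -(expn0 q) eqn_exp2l.
  have -> : (q ^ c.+2 == q)%N = false by rewrite -{2}(expn1 q) eqn_exp2l.
  by rewrite !muln0 !subn0 -addn2 expnD mulnK ?expn_gt0 ?q0 // mulnC.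
have [[|[|c]] ->] := kE x.
- by rewrite expn0 eqxx (ltn_eqF q1) !(muln0, subn0, subnn, mul0n, div0n, addn0).
- by rewrite expn1 eqxx (gtn_eqF q1) !(muln1, muln0, subn0, subnn, mul0n, div0n, addn0).
have -> : (q ^ c.+2 == 1)%N = false by rewrite -(expn0 q) eqn_exp2l.
have -> : (q ^ c.+2 == q)%N = false by rewrite -{2}(expn1 q) eqn_exp2l.
rewrite !muln0 !subn0 -[c.+2]addn2 expnD mulnK ?expn_gt0 ?q0 //.
rewrite (_ : q ^ c * (q ^ c * q ^ 2) = q ^ c * q ^ c * q * q)%N ?mulnK //; last first.
  by rewrite expnS expn1 !mulnA.
by rewrite add0n; ring.
Qed.

End LinearCounting.

(** * Counting isotropic quadruples *)

Section Lagrangian.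
Variables (F : finFieldType) (n h N : nat).
Variables (A : 'M[F]_(n, N)) (B : 'M[F]_(h, N)).
Local Notation q := #|F|.
Implicit Types (u : 'rV[F]_n) (v : 'rV[F]_h) (I J K P Q : {set 'I_N}).

(** For each [e] the pairs (y_e, z_e) and (y'_e, z'_e) in F^2, with y taken from [A] and z from [B],
    are linearly dependent. *)
Definition isotropic u u' v v' :=
  [forall e, (u *m A) 0 e * (v' *m B) 0 e == (u' *m A) 0 e * (v *m B) 0 e].

Definition nsol Q u u' : nat :=
  (\sum_v \sum_v' [&& vanish B Q v, vanish B Q v' & isotropic u u' v v'])%N.

Definition nquad P Q : nat :=
  (\sum_u \sum_u' (vanish A P u && vanish A P u') * nsol Q u u')%N.

Lemma vanish_transvection (m : nat) (M : 'M[F]_(m, N)) Q (t : F) (x y : 'rV_m) :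
  vanish M Q x -> vanish M Q (y + t *: x) = vanish M Q y.
Proof.
move=> /forall_inP x0; apply: eq_forallb_in => e Qe.
by rewrite mulmxDZl_entry (eqP (x0 e Qe)) mulr0 addr0.
Qed.

(** The shift of v' by t v compensates that of u' by t u: both sides of each equation gain t y_e
    z_e. *)
Lemma nsol_transvection Q u u' t : nsol Q u (u' + t *: u) = nsol Q u u'.
Proof.
apply: eq_bigr => v _; rewrite (reindex_inj (addIr (t *: v))) /=.
apply: eq_bigr => v' _; case vQ: (vanish B Q v) => //=.
rewrite vanish_transvection //; congr (nat_of_bool (_ && _)).
apply: eq_forallb => e; rewrite !mulmxDZl_entry.
by rewrite mulrDr mulrDl mulrCA -mulrA (inj_eq (addIr _)).
Qed.

(** When the first argument is 0, the equations do not involve v', which then runs over a whole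
    space of codimension at most [#|Q|]. *)
Lemma dvdn_nsol0 Q u : (q ^ (h - #|Q|) %| nsol Q 0 u)%N.
Proof.
rewrite /nsol exchange_big /=.
rewrite (eq_bigr (fun v' => vanish B Q v' *
  \sum_v (vanish B Q v && [forall e, ((u *m A) 0 e * (v *m B) 0 e == 0)%R]))%N).
  by rewrite -big_distrl /= dvdn_mulr // dvdn_vanish.
move=> v' _; rewrite big_distrr; apply: eq_bigr => v _ /=; rewrite mulnb.
rewrite andbCA; congr (nat_of_bool (_ && (_ && _))); apply: eq_forallb => e.
by rewrite mul0mx mxE mul0r eq_sym.
Qed.

Hypothesis orthAB : A *m B^T = 0.

Lemma sum_orth u v : \sum_e (u *m A) 0 e * (v *m B) 0 e = 0.
Proof.
have /rowP/(_ 0) : (u *m A) *m (v *m B)^T = 0.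
  by rewrite trmx_mul mulmxA -(mulmxA u) orthAB mulmx0 mul0mx.
rewrite mxE [RHS]mxE => E; rewrite -[RHS]E; apply: eq_bigr => e _.
by congr (_ * _); rewrite [RHS]mxE.
Qed.

(* Summing the equations of [isotropic] over all [e] gives the trivial identity
   [sum_orth], so that one of them may be dropped. *)
Lemma dvdn_nsol P Q u u' e0 : vanish A P u -> vanish A P u' ->
  e0 \notin P :|: Q ->
  (q ^ (2 * h + 1 + #|P :|: Q| - (2 * #|Q| + N)) %| nsol Q u u')%N.
Proof.
move=> /forall_inP uP /forall_inP u'P e0PQ.
(* The equations at indices of [P] or [Q] read 0 = 0, and the one at [e0] is redundant. There remain
   2 #|Q| + #|R| linear equations in 2 h unknowns. *)
pose R := ~: (P :|: Q) :\ e0.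
pose c1 e := col_mx (col e B) (0 : 'cV_h).
pose c2 e := col_mx (0 : 'cV_h) (col e B).
pose c3 e := col_mx (- (u' *m A) 0 e *: col e B) ((u *m A) 0 e *: col e B).
pose s := [seq c1 e | e <- enum Q] ++ [seq c2 e | e <- enum Q] ++
          [seq c3 e | e <- enum R].
suff -> : nsol Q u u' = #|[set x : 'rV_(h + h) | all (fun c => x *m c == 0) s]|.
  apply: dvdn_trans (dvdn_solutions s); apply: dvdn_exp2l.
  rewrite !size_cat !size_map -!cardE.
  have EN : (#|P :|: Q| + (1 + #|R|) = N)%N.
    by rewrite -[RHS](card_ord N) -(cardsC (P :|: Q)) (cardsD1 e0 (~: _)) in_setC e0PQ.
  move: EN; move: #|P :|: Q| #|Q| #|R| => ? ? ?; lia.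
rewrite /nsol pair_big /= (reindex (fun x => (lsubmx x, rsubmx x))) /=; last first.
  exists (fun p => row_mx p.1 p.2) => [x|[v v']] _ /=; first by rewrite hsubmxK.
  by rewrite row_mxKl row_mxKr.
rewrite -sum1_card [RHS]big_mkcond; apply: eq_bigr => x _.
rewrite inE; set v := lsubmx x; set v' := rsubmx x.
suff -> : all (fun c => x *m c == 0) s =
  [&& vanish B Q v, vanish B Q v' & isotropic u u' v v'] by case: ([&& _, _ & _]).
rewrite -[x](hsubmxK x) -/v -/v' !all_cat !vanish_all !all_map.
have Ev e : (row_mx v v' *m c1 e == 0) = (v *m col e B == 0).
  by rewrite mul_row_col mulmx0 addr0.
have Ev' e : (row_mx v v' *m c2 e == 0) = (v' *m col e B == 0).
  by rewrite mul_row_col mulmx0 add0r.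
rewrite (eq_all Ev) (eq_all Ev'); apply: andb_id2l => allv; apply: andb_id2l => allv'.
have vQ e : e \in Q -> (v *m B) 0 e = 0 /\ (v' *m B) 0 e = 0.
  move=> Qe; split; apply/eqP; rewrite -mul_col_eq0.
    by apply: (allP allv); rewrite mem_enum.
  by apply: (allP allv'); rewrite mem_enum.
have Ec3 e : (row_mx v v' *m c3 e == 0) =
    ((u *m A) 0 e * (v' *m B) 0 e == (u' *m A) 0 e * (v *m B) 0 e).
  rewrite mul_row_col -!scalemxAr addrC scaleNr subr_eq0.
  have Ecol (w : 'rV_h) : w *m col e B = ((w *m B) 0 e)%:M.
    apply/rowP => i; rewrite ord1 !mxE eqxx mulr1n.
    by apply: eq_bigr => j _; rewrite mxE.
  rewrite !Ecol !scale_scalar_mx; apply/eqP/eqP => [/matrixP/(_ 0 0)|->//].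
  by rewrite ![_%:M 0 0]mxE.
rewrite (eq_all Ec3); apply/allP/forallP => [HR e|iso e _ /=]; last exact: iso.
have HR' : forall e, e != e0 ->
    ((u *m A) 0 e * (v' *m B) 0 e == (u' *m A) 0 e * (v *m B) 0 e).
  move=> {}e ne; have [Qe|nQe] := boolP (e \in Q).
    by have [-> ->] := vQ e Qe; rewrite !mulr0.
  have [Pe|nPe] := boolP (e \in P).
    by rewrite (eqP (uP e Pe)) (eqP (u'P e Pe)) !mul0r.
  by apply: (HR e); rewrite mem_enum !inE ne negb_or nPe nQe.
have [->|] := eqVneq e e0; last exact: HR'.
have /eqP := etrans (sum_orth u v') (esym (sum_orth u' v)).
rewrite (bigD1 e0) //= [X in _ == X](bigD1 e0) //=.
rewrite [X in _ + X == _](eq_bigr (fun e => (u' *m A) 0 e * (v *m B) 0 e)).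
  by rewrite (inj_eq (addIr _)).
by move=> ? ?; apply/eqP/HR'.
Qed.

(** For u nonzero the transvections add a factor q to [dvdn_nsol], whence the 2 in place of 1 in the
    second hypothesis. The first hypothesis serves the cases u = 0 and [P :|: Q] full. *)
Lemma dvdn_nquad P Q d :
  (d + #|Q| <= h)%N -> (d + 2 * #|Q| + N <= 2 * h + 2 + #|P :|: Q|)%N ->
  (q ^ d %| nquad P Q)%N.
Proof.
move=> dh dN; have dQ : (q ^ d %| q ^ (h - #|Q|))%N by apply: dvdn_exp2l; lia.
have [/eqP PQT|] := boolP (P :|: Q == setT); last first.
  rewrite eqEsubset subsetT /= => /subsetPn[e0 _ e0PQ].
  apply: dvdn_sum => u _; have [->|u0] := eqVneq u 0.
    by apply: dvdn_sum => u' _; apply: dvdn_mull; apply: dvdn_trans dQ (dvdn_nsol0 _ _).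
  have [i ui0] : exists i, u 0 i != 0.
    apply/existsP; rewrite -negb_forall; apply: contra u0 => /forallP u0.
    by apply/eqP/rowP => i; rewrite mxE; apply/eqP.
  have [uP|] := boolP (vanish A P u); last by rewrite /= big1 // => *; exact: mul0n.
  rewrite /= (sum_transvection ui0) => [|t x]; last first.
    by rewrite vanish_transvection // nsol_transvection.
  case: d dh dN dQ => [|d] dh dN dQ; first by rewrite dvd1n.
  rewrite expnS dvdn_mul // dvdn_sum // => x _.
  have [xP|] := boolP (vanish A P x); rewrite ?mul0n ?dvdn0 // mul1n.
  by apply: dvdn_trans (dvdn_nsol uP xP e0PQ); apply: dvdn_exp2l; lia.
(* Here every isotropy equation reads 0 = 0, and v and v' vary independently. *)
apply: dvdn_sum => u _; apply: dvdn_sum => u' _.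
case: andP => [[/forall_inP uP /forall_inP u'P]|_]; rewrite ?mul0n ?dvdn0 // mul1n.
rewrite /nsol (eq_bigr (fun v => vanish B Q v * \sum_v' vanish B Q v'))%N.
  by rewrite -big_distrl /= dvdn_mulr // (dvdn_trans dQ) // dvdn_vanish.
move=> v _; rewrite big_distrr; apply: eq_bigr => v' _ /=; rewrite mulnb.
congr nat_of_bool; apply: andb_id2l => /forall_inP vQ.
rewrite -[RHS]andbT; apply: andb_id2l => /forall_inP v'Q.
apply/forallP => e; have : e \in P :|: Q by rewrite PQT inE.
rewrite inE => /orP[eP|eQ]; first by rewrite (eqP (uP e eP)) (eqP (u'P e eP)) !mul0r.
by rewrite (eqP (vQ e eQ)) (eqP (v'Q e eQ)) !mulr0.
Qed.

End Lagrangian.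

(** * Moments of the kernel size over products of projective lines *)

Section Lines.
Variables (F : finFieldType) (n h N : nat).
Variables (A : 'M[F]_(n, N)) (B : 'M[F]_(h, N)).
Local Notation q := #|F|.
Implicit Types (u : 'rV[F]_n) (v : 'rV[F]_h) (I J K : {set 'I_N}).
Implicit Types (l : {ffun 'I_N -> option F}).

(* [Some x] stands for the point [(x : 1)] of the projective line and [None] for
   the point [(1 : 0)]. *)
Definition kills (o : option F) (y z : F) : bool :=
  if o is Some x then x * y + z == 0 else y == 0.

Definition killed l u v :=
  [forall e, kills (l e) ((u *m A) 0 e) ((v *m B) 0 e)].

(** A kernel size ([nker_pow]), which extends that of the pencil ([pker_nker]) to points at
    infinity. *)
Definition nker l : nat := (\sum_u \sum_v killed l u v)%N.

Definition pinned I J l :=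
  [forall e, ((e \in I) ==> (l e == Some 0)) && ((e \in J) ==> (l e == None))].

(** This is the count Y if both sets are empty, and Y_J if exactly one of them is. *)
Definition nondeg I J : nat := (\sum_(l | pinned I J l) (nker l == 1))%N.

Lemma kills_uniq y z : (y != 0) || (z != 0) ->
  forall o, kills o y z = (o == if y == 0 then None else Some (- z / y)).
Proof.
move=> nz [x|] /=; have [y0|y0] := eqVneq y 0; rewrite ?y0 ?eqxx //=.
  by rewrite mulr0 add0r; rewrite y0 eqxx in nz; apply: negPf.
rewrite addr_eq0 (inj_eq Some_inj) -[RHS](inj_eq (mulIf y0)) mulfVK //.
Qed.

Lemma kills_sym y z y' z' : (y != 0) || (z != 0) ->
  kills (if y == 0 then None else Some (- z / y)) y' z' = (y * z' == y' * z).
Proof.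
have [->|y0] := eqVneq y 0 => /= [z0|_].
  by rewrite mul0r [RHS]eq_sym mulf_eq0 (negPf z0) orbF.
rewrite -(inj_eq (mulIf y0)) mul0r mulrDl mulrAC mulfVK // addrC mulNr subr_eq0.
by rewrite mulrC [z * _]mulrC.
Qed.

(** A nonzero pair leaves one candidate point, which kills the other pair exactly when the two are
    dependent. If both pairs are 0, all q + 1 points qualify, one of them being accounted for by the
    first term. *)
Lemma sum_kills y z y' z' :
  (\sum_o (kills o y z && kills o y' z') =
   (y * z' == y' * z)%R + q * ((y == 0%R) && (z == 0%R) && ((y' == 0%R) && (z' ==
     0%R))))%N.
Proof.
have sum_pred1 (o0 : option F) (P : pred (option F)) :
    (\sum_o ((o == o0) && P o) = P o0)%N.
  by rewrite (bigD1 o0) //= eqxx big1 ?addn0 // => o /negPf->.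
have [/orP nz|] := boolP ((y != 0) || (z != 0)).
  have /negPf -> : ~~ ((y == 0) && (z == 0)) by rewrite negb_and; apply/orP.
  move/orP: nz => nz; rewrite muln0 addn0 -(kills_sym _ _ nz).
  by under eq_bigr do rewrite (kills_uniq nz); rewrite sum_pred1.
rewrite negb_or !negbK => /andP[/eqP-> /eqP->]; rewrite mul0r mulr0 !eqxx /=.
have k0 o : kills o 0 0 by case: o => [x|] /=; rewrite ?mulr0 ?addr0 eqxx.
under eq_bigr do rewrite k0 /=.
have [nz|] := boolP ((y' != 0) || (z' != 0)).
  have /negPf -> : ~~ ((y' == 0) && (z' == 0)) by rewrite negb_and.
  under eq_bigr do rewrite (kills_uniq nz) -[_ == _]andbT.
  by rewrite (sum_pred1 _ xpredT) muln0.
rewrite negb_or !negbK => /andP[/eqP-> /eqP->]; rewrite eqxx /= muln1.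
under eq_bigr do rewrite k0.
by rewrite sum_nat_const card_option muln1 add1n.
Qed.

Lemma sum_pinned_kills I J e y z y' z' : [disjoint I & J] ->
  (\sum_o [&& (e \in I) ==> (o == Some 0%R), (e \in J) ==> (o == None),
             kills o y z & kills o y' z'] =
   q * [&& e \notin I :|: J, (y == 0%R) && (z == 0%R) & (y' == 0%R) && (z' == 0%R)] +
   [&& (e \in I) ==> ((z == 0%R) && (z' == 0%R)),
       (e \in J) ==> ((y == 0%R) && (y' == 0%R)) & (y * z' == y' * z)%R])%N.
Proof.
move=> dIJ; rewrite inE negb_or.
have [eI|eI] /= := boolP (e \in I).
  have -> : e \in J = false by apply: (disjointFr dIJ).
  rewrite muln0 (bigD1 (Some 0)) //= eqxx !mul0r !add0r big1 => [|o /negPf->] //.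
  rewrite addn0; congr nat_of_bool.
  by case: eqP => //= ->; case: eqP => //= ->; rewrite !mulr0 eqxx.
have [eJ|eJ] /= := boolP (e \in J).
  rewrite muln0 (bigD1 None) //= big1 => [|o /negPf->] //.
  rewrite addn0; congr nat_of_bool.
  by case: eqP => //= ->; case: eqP => //= ->; rewrite !mul0r eqxx.
by rewrite sum_kills addnC.
Qed.

(** The sum over [l] is a product over the indices. In the expansion of the two-term factors of
    [sum_pinned_kills], [K] is the set of indices where the term with q is taken. *)
Lemma sum_pinned I J u u' v v' : [disjoint I & J] ->
  (\sum_(l | pinned I J l)
     killed l u v * killed l u' v' =
   \sum_(K : {set 'I_N} | [disjoint K & I :|: J]) q ^ #|K| *
     ((vanish A (J :|: K) u && vanish A (J :|: K) u') *
      [&& vanish B (I :|: K) v, vanish B (I :|: K) v' & isotropic A B u u' v v']))%N.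
Proof.
move=> dIJ; pose y e := (u *m A) 0 e; pose y' e := (u' *m A) 0 e.
pose z e := (v *m B) 0 e; pose z' e := (v' *m B) 0 e.
transitivity (\prod_(e < N) \sum_o [&& (e \in I) ==> (o == Some 0%R),
  (e \in J) ==> (o == None), kills o (y e) (z e) & kills o (y' e) (z' e)])%N.
  rewrite bigA_distr_bigA /= big_mkcond; apply: eq_bigr => l _.
  rewrite -natb_forall mulnb.
  transitivity ((pinned I J l && ([forall e, kills (l e) (y e) (z e)] &&
     [forall e, kills (l e) (y' e) (z' e)])) : nat); first by case: (pinned I J l).
  congr nat_of_bool; apply/andP/forallP => [[/forallP pl /andP[/forallP k1 /forallP
    k2]] e|H].
    by rewrite k1 k2 !andbT.
  split; first by apply/forallP => e; case/and4P: (H e) => -> ->.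
  by apply/andP; split; apply/forallP => e; case/and4P: (H e).
under eq_bigr do rewrite sum_pinned_kills //.
rewrite bigA_distr [RHS]big_mkcond /=; apply: eq_bigr => K _.
rewrite (bigID (mem K)) /=.
rewrite (eq_bigr (fun e => q * [&& e \notin I :|: J, (y e == 0%R) && (z e == 0%R)
  & (y' e == 0%R) && (z' e == 0%R)])%N); last by move=> e ->.
rewrite big_split /= prod_nat_const -mulnA.
set b1 := (\prod_(e in K) _)%N; set b2 := (\prod_(e | e \notin K) _)%N.
have -> : b1 = [forall e in K, [&& e \notin I :|: J, (y e == 0%R) && (z e == 0%R)
  & (y' e == 0%R) && (z' e == 0%R)]] :> nat.
  by rewrite natb_forall /b1 big_mkcond; apply: eq_bigr => e _; case: (e \in K).
have -> : b2 = [forall e, (e \notin K) ==>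
    [&& (e \in I) ==> ((z e == 0%R) && (z' e == 0%R)),
        (e \in J) ==> ((y e == 0%R) && (y' e == 0%R)) &
        (y e * z' e == y' e * z e)%R]] :> nat.
  rewrite natb_forall /b2 big_mkcond; apply: eq_bigr => e _.
  by case: (e \in K).
rewrite !mulnb; case: ifP => [dK|ndK]; last first.
  case: forall_inP => //= H; rewrite ?muln0 //; move/negP: ndK; case.
  rewrite disjoint_subset; apply/subsetP => e eK.
  by have /and3P[] := H e eK; rewrite !inE.
congr (_ * nat_of_bool _)%N; apply/andP/andP.
  move=> [/forall_inP H1 /forall_inP H2];
    have Hyz e : [/\ e \in J :|: K -> (y e == 0) && (y' e == 0),
    e \in I :|: K -> (z e == 0) && (z' e == 0) & y e * z' e == y' e * z e].
    have [eK|eK] := boolP (e \in K).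
      have /and3P[_ /andP[/eqP-> /eqP->] /andP[/eqP-> /eqP->]] := H1 e eK.
      by rewrite mul0r eqxx.
    have /and3P[HI HJ ->] := H2 e eK; rewrite !inE (negPf eK) !orbF.
    by split=> // eX; [move: HJ|move: HI]; rewrite eX.
  split; first by apply/andP; split;
    apply/forall_inP => e /(let: And3 H _ _ := Hyz e in H) /andP[].
  apply/and3P; split; last by apply/forallP => e; have [] := Hyz e.
    by apply/forall_inP => e /(let: And3 _ H _ := Hyz e in H) /andP[].
  by apply/forall_inP => e /(let: And3 _ H _ := Hyz e in H) /andP[].
move=> [/andP[/forall_inP Hy /forall_inP Hy'] /and3P[/forall_inP Hz /forall_inP Hz'
  /forallP iso]].
split; apply/forall_inP => e eK.
  rewrite (disjointFr dK eK) /= Hy ?Hy' ?Hz ?Hz' // inE eK orbT //.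
apply/and3P; split; last exact: iso.
  by apply/implyP => eI; apply/andP; split; [apply: Hz|apply: Hz']; rewrite inE eI.
by apply/implyP => eJ; apply/andP; split; [apply: Hy|apply: Hy']; rewrite inE eJ.
Qed.

Lemma sum_nker2 I J : [disjoint I & J] ->
  (\sum_(l | pinned I J l) nker l ^ 2 =
   \sum_(K : {set 'I_N} | [disjoint K & I :|: J]) q ^ #|K| * nquad A B (J :|: K) (I
     :|: K))%N.
Proof.
move=> dIJ.
transitivity (\sum_u \sum_u' \sum_v \sum_v' \sum_(l | pinned I J l)
     killed l u v * killed l u' v')%N.
  under [RHS]eq_bigr => u _ do (under eq_bigr => u' _ do
    (under eq_bigr => v _ do rewrite exchange_big; rewrite exchange_big);
      rewrite exchange_big).
  rewrite exchange_big; apply: eq_bigr => l _ /=; rewrite -mulnn /nker big_distrlr /=.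
  by apply: eq_bigr => u _; apply: eq_bigr => u' _; rewrite big_distrlr.
under eq_bigr => u _ do under eq_bigr => u' _ do under eq_bigr => v _ do under
  eq_bigr => v' _ do
  rewrite (sum_pinned u u' v v' dIJ).
under eq_bigr => u _ do (under eq_bigr => u' _ do
    (under eq_bigr => v _ do rewrite exchange_big; rewrite exchange_big);
      rewrite exchange_big).
rewrite exchange_big; apply: eq_bigr => K _ /=; rewrite /nquad /nsol.
rewrite big_distrr; apply: eq_bigr => u _ /=; rewrite big_distrr;
  apply: eq_bigr => u' _ /=.
rewrite !big_distrr; apply: eq_bigr => v _ /=; rewrite !big_distrr.
by apply: eq_bigr => v' _ /=; rewrite !mulnb.
Qed.

(** The diagonal case (u', v') = (u, v) of [sum_pinned], where isotropy is automatic. *)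
Lemma sum_nker I J : [disjoint I & J] ->
  (\sum_(l | pinned I J l) nker l =
   \sum_(K : {set 'I_N} | [disjoint K & I :|: J]) q ^ #|K| *
     ((\sum_u vanish A (J :|: K) u) * (\sum_v vanish B (I :|: K) v)))%N.
Proof.
move=> dIJ.
rewrite exchange_big /=; under eq_bigr => u _ do rewrite exchange_big /=.
under eq_bigr => u _ do under eq_bigr => v _ do
  (under eq_bigr => l _ do rewrite -[X in nat_of_bool X]andbb -mulnb;
    rewrite (sum_pinned u u v v dIJ)).
under eq_bigr => u _ do rewrite exchange_big.
rewrite exchange_big; apply: eq_bigr => K _ /=.
rewrite big_distrlr big_distrr; apply: eq_bigr => u _ /=.
rewrite big_distrr; apply: eq_bigr => v _ /=.
rewrite (_ : isotropic _ _ _ _ _ _ = true) ?andbT ?andbb //.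
by apply/forallP => e.
Qed.

End Lines.

(** * Divisibility of the number of nondegenerate points *)

Section Degeneracy.
Variable F : finFieldType.
Local Notation q := #|F|.

Lemma nker_pow (n h N : nat) (A : 'M[F]_(n, N)) (B : 'M[F]_(h, N)) l :
  exists c, nker A B l = (q ^ c)%N.
Proof.
(* The pair (a e, b e) is a vector of homogeneous coordinates of the point [l e]. *)
pose a e := if l e is Some x then x else 1.
pose b e : F := if l e is Some _ then 1 else 0.
pose M := col_mx (\matrix_(i, e) (A i e * a e)) (\matrix_(i, e) (B i e * b e)).
exists (n + h - \rank M)%N; rewrite -card_ker -sum1_card [RHS]big_mkcond /=.
rewrite /nker pair_big /= (reindex (fun x => (lsubmx x, rsubmx x))) /=; last first.
  exists (fun p => row_mx p.1 p.2) => [x|[u v]] _ /=; first by rewrite hsubmxK.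
  by rewrite row_mxKl row_mxKr.
apply: eq_bigr => x _; rewrite inE -[in RHS](hsubmxK x) mul_row_col.
set u := lsubmx x; set v := rsubmx x.
suff -> : (u *m (\matrix_(i, e) (A i e * a e)) + v *m (\matrix_(i, e) (B i e * b e)) == 0)
  = killed A B l u v by case: (killed _ _ _ _ _).
have Emul k (C : 'M[F]_(k, N)) (w : 'rV_k) (d : 'I_N -> F) e :
    (w *m (\matrix_(i, e) (C i e * d e))) 0 e = d e * (w *m C) 0 e.
  by rewrite !mxE big_distrr; apply: eq_bigr => i _ /=; rewrite mxE mulrA mulrC.
have Ee e : kills (l e) ((u *m A) 0 e) ((v *m B) 0 e) =
    (a e * (u *m A) 0 e + b e * (v *m B) 0 e == 0).
  by rewrite /a /b; case: (l e) => [y|] /=; rewrite !mul1r ?mul0r ?addr0.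
apply/eqP/forallP => [/rowP H e|H].
  by rewrite Ee -!Emul; have := H e; rewrite mxE => ->; rewrite mxE.
by apply/rowP => e; rewrite mxE !Emul [RHS]mxE; apply/eqP; rewrite -Ee.
Qed.

Section Divisibility.
Variables (n h N : nat) (A : 'M[F]_(n, N)) (B : 'M[F]_(h, N)).
Hypotheses (orthAB : A *m B^T = 0) (dimN : N = (n + h)%N).
Implicit Types I J : {set 'I_N}.

(** In the term of [K], the factor [q ^ #|K|] leaves the exponent d - #|K| to [dvdn_nquad]; there
    [#|K|] cancels from both numerical conditions. *)
Lemma dvdn_sum_nker2 I J d : [disjoint I & J] ->
  (d + #|I| <= h)%N -> (d + #|I| + n <= h + #|J| + 2)%N ->
  (q ^ d %| \sum_(l | pinned I J l) nker A B l ^ 2)%N.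
Proof.
move=> dIJ dI dIJn; rewrite sum_nker2 //; apply: dvdn_sum => K dK.
have [dk|kd] := leqP d #|K|; first by rewrite dvdn_mulr // dvdn_exp2l.
rewrite -(subnKC (ltnW kd)) expnD dvdn_mul //.
have cIK : #|I :|: K| = (#|I| + #|K|)%N.
  apply/eqP; rewrite (leq_card_setU I K) disjoint_sym.
  by apply: disjointWr dK; apply: subsetUl.
have cIJK : #|J :|: K :|: (I :|: K)| = (#|I| + #|J| + #|K|)%N.
  have IJ0 : I :&: J = set0 by apply/eqP; rewrite setI_eq0.
  have K0 : (I :|: J) :&: K = set0 by apply/eqP; rewrite setIC setI_eq0.
  by rewrite setUACA setUid (setUC J I) !cardsU K0 IJ0 cards0 !subn0.
apply: dvdn_nquad => //.
  by rewrite cIK; move: #|I| #|K| dI kd => i k *; lia.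
rewrite cIK cIJK; have := dimN.
by move: #|I| #|K| #|J| dI kd dIJn => i k j *; lia.
Qed.

Lemma dvdn_sum_nker I J : [disjoint I & J] ->
  (q ^ (h - #|I|) %| \sum_(l | pinned I J l) nker A B l)%N.
Proof.
move=> dIJ; rewrite sum_nker //; apply: dvdn_sum => K _.
rewrite mulnCA dvdn_mull //.
apply: (@dvdn_trans (q ^ (#|K| + (h - #|I :|: K|)))%N).
  apply: dvdn_exp2l; have := leq_card_setU I K.
  by case=> H _; move: #|I| #|K| #|I :|: K| H => i k m *; lia.
by rewrite expnD dvdn_mul // dvdn_vanish.
Qed.

Lemma nondeg_nondisjoint I J : ~~ [disjoint I & J] -> nondeg A B I J = 0%N.
Proof.
rewrite -setI_eq0 => /set0Pn[e]; rewrite inE => /andP[eI eJ].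
rewrite /nondeg big_pred0 // => l; apply/forallP => /(_ e).
by rewrite eI eJ /= => /andP[/eqP->].
Qed.

Lemma dvdn_nondeg2 I J : (2 + #|I| <= h)%N -> (#|I| + n <= h + #|J|)%N ->
  (q ^ 2 %| nondeg A B I J)%N.
Proof.
move=> hI hJ; have [dIJ|] := boolP [disjoint I & J]; last first.
  by move/nondeg_nondisjoint->.
have [C [m1 [m2 [_ E2]]]] := sum_powers (pinned I J) (nker_pow A B).
have : (q ^ 2 %| \sum_(l | pinned I J l) nker A B l ^ 2)%N.
  by apply: dvdn_sum_nker2 => //; move: hI hJ; move: #|I| #|J| => i j *; lia.
by rewrite (dvdn2_powers E2).
Qed.

(** The moments of [nker] are divisible by q^2 and q^3, as [dvdn3_powers] requires. For n = h the
    condition on [J] says that it is nonempty. *)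
Lemma dvdn_nondeg3 J : (3 <= h)%N -> (n < h + #|J|)%N ->
  (q ^ 3 %| nondeg A B set0 J)%N.
Proof.
move=> h3 hJ; have q0 : (0 < q)%N by rewrite ltnW // card_finNzRing_gt1.
have d0 : [disjoint set0 & J] by rewrite -setI_eq0 set0I.
have [C [m1 [m2 [E1 E2]]]] := sum_powers (pinned set0 J) (nker_pow A B).
apply: (dvdn3_powers E1 E2) => //.
  by apply: dvdn_trans (dvdn_sum_nker d0); rewrite cards0 subn0 dvdn_exp2l // ltnW.
by apply: dvdn_sum_nker2; rewrite ?cards0 //; move: hJ; move: #|J| => j *; lia.
Qed.

End Divisibility.

(** The inversion x -> 1/x of the projective line exchanges 0 with infinity, and the two coordinates
    y and z. *)
Lemma nondeg_swap (n h N : nat) (A : 'M[F]_(n, N)) (B : 'M[F]_(h, N)) I J :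
  nondeg A B I J = nondeg B A J I.
Proof.
pose sw (o : option F) :=
  if o is Some x then if x == 0 then None else Some x^-1 else Some 0.
have swK : involutive sw.
  case=> [x|] /=; last by rewrite eqxx.
  by have [->|x0] //= := eqVneq x 0; rewrite invr_eq0 (negPf x0) invrK.
have sw0 o : (sw o == Some 0) = (o == None).
  by apply/eqP/eqP => [E|->//]; rewrite -[o]swK E /= eqxx.
have swN o : (sw o == None) = (o == Some 0).
  by apply/eqP/eqP => [E|->]; rewrite /= ?eqxx // -[o]swK E.
pose swf (l : {ffun 'I_N -> option F}) := [ffun e => sw (l e)].
have swfK : involutive swf by move=> l; apply/ffunP => e; rewrite !ffunE swK.
rewrite /nondeg (reindex_inj (inv_inj swfK)); apply: eq_big => [l|l _].
  by apply: eq_forallb => e; rewrite ffunE sw0 swN andbC.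
rewrite /nker exchange_big /=; congr (nat_of_bool (_ == _)).
apply: eq_bigr => v _; apply: eq_bigr => u _; congr nat_of_bool.
apply: eq_forallb => e; rewrite ffunE; case: (l e) => [x|] /=.
  have [->|x0] /= := eqVneq x 0; first by rewrite mul0r add0r.
  by rewrite -[RHS](inj_eq (mulfI (invr_neq0 x0))) mulr0 mulrDr mulKf // addrC.
by rewrite mul0r add0r.
Qed.

End Degeneracy.

(** * Systems of quadrics and the pencil *)

Section Pencil.
Variable F : finFieldType.
Local Notation q := #|F|.

Lemma row_ffun_bij (N : nat) :
  bijective (fun f : {ffun 'I_N -> F} => \row_e f e).
Proof.
exists (fun r : 'rV_N => [ffun e => r 0 e]) => [f|r].
  by apply/ffunP => e; rewrite ffunE mxE.
by apply/rowP => e; rewrite mxE ffunE.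
Qed.

Lemma sum_row_prod (N : nat) (g : 'I_N -> F -> nat) :
  (\sum_(r : 'rV[F]_N) \prod_e g e (r 0%R e) = \prod_e \sum_t g e t)%N.
Proof.
rewrite bigA_distr_bigA (reindex _ (onW_bij _ (row_ffun_bij N))) /=.
by apply: eq_bigr => f _; apply: eq_bigr => e _; rewrite mxE.
Qed.

Definition pencil (n N : nat) (A : 'M[F]_(n, N)) (al : 'rV[F]_N) : 'M[F]_n :=
  A *m diag_mx al *m A^T.

Definition pker (n N : nat) (A : 'M[F]_(n, N)) (al : 'rV[F]_N) : nat :=
  (\sum_(u : 'rV[F]_n) (u *m pencil A al == 0%R))%N.

Definition zero_on (N : nat) (I : {set 'I_N}) (al : 'rV[F]_N) :=
  [forall e in I, al 0 e == 0].

Definition nreg (n N : nat) (A : 'M[F]_(n, N)) (I : {set 'I_N}) : nat :=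
  (\sum_(al | zero_on I al) (pker A al == 1))%N.

Lemma pker_rank (n N : nat) (A : 'M[F]_(n, N)) al :
  pker A al = (q ^ (n - \rank (pencil A al)))%N.
Proof.
rewrite -card_ker -sum1_card [RHS]big_mkcond.
by apply: eq_bigr => u _; rewrite inE; case: eqP.
Qed.

Lemma pker_pow (n N : nat) (A : 'M[F]_(n, N)) al : exists c, pker A al = (q ^ c)%N.
Proof. by exists (n - \rank (pencil A al))%N; exact: pker_rank. Qed.

Lemma mul_diag_entry (m N : nat) (M : 'M[F]_(m, N)) (u : 'rV_m) d e :
  (u *m (M *m diag_mx d)) 0 e = (u *m M) 0 e * d 0 e.
Proof. by rewrite mulmxA mul_mx_diag mxE. Qed.

Lemma mul_diagC (N : nat) (d d' : 'rV[F]_N) : d *m diag_mx d' = d' *m diag_mx d.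
Proof. by apply/rowP => e; rewrite !mul_mx_diag !mxE mulrC. Qed.

(** For fixed u the conditions on [al] are linear: n from the pencil and [#|I|] from [zero_on]. *)
Lemma dvdn_sum_pker (n N : nat) (A : 'M[F]_(n, N)) (I : {set 'I_N}) :
  (q ^ (N - (#|I| + n)) %| \sum_(al | zero_on I al) pker A al)%N.
Proof.
rewrite exchange_big; apply: dvdn_sum => u _ /=.
pose C := diag_mx (u *m A) *m A^T.
pose s := [seq (delta_mx e 0 : 'cV[F]_N) | e <- enum I] ++
          [seq col i C | i <- enum [set: 'I_n]].
have sz : size s = (#|I| + n)%N by rewrite size_cat !size_map -!cardE cardsT card_ord.
have := dvdn_solutions s; rewrite sz -[#|finset _|]sum1_card.
rewrite [X in (_ %| X)%N -> _]big_mkcond [X in _ -> (_ %| X)%N]big_mkcond /=.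
rewrite (eq_bigr (fun al => if zero_on I al then (u *m pencil A al == 0) : nat else
  0%N)) //.
move=> al _; rewrite inE all_cat !all_map.
have -> : all (preim (fun e => delta_mx e 0 : 'cV[F]_N) (fun c => al *m c == 0))
  (enum I) = zero_on I al.
  have E e : (al *m delta_mx e (0 : 'I_1) == 0) = (al 0 e == 0).
    rewrite -colE; apply/eqP/eqP => [/rowP/(_ 0)|al0]; first by rewrite !mxE.
    by apply/rowP => i; rewrite ord1 !mxE.
  apply/idP/idP => [/allP H|/forall_inP H].
    by apply/forall_inP => e eI; rewrite -E; apply: (H e); rewrite mem_enum.
  by apply/allP => e; rewrite mem_enum /= E; apply: H.
have -> : all (preim (fun i => col i C) (fun c => al *m c == 0)) (enum [set: 'I_n]) =
  (u *m pencil A al == 0).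
  have -> : u *m pencil A al = al *m C by rewrite /pencil /C !mulmxA -[al *m _]mul_diagC.
  apply/allP/eqP => [H|H i _ /=]; last by rewrite mul_col_eq0 H mxE.
  apply/rowP => i; rewrite [RHS]mxE; apply/eqP; rewrite -mul_col_eq0.
  by apply: (H i); rewrite mem_enum inE.
by case: (zero_on I al); case: (_ == 0).
Qed.

Definition nquadrics (n N : nat) (A : 'M[F]_(n, N)) (S : {set 'I_N}) : nat :=
  (\sum_(x1 : 'rV[F]_n) \sum_(x3 : 'rV[F]_n) \sum_(x2 : 'rV[F]_n)
   \sum_(x4 : 'rV[F]_n)
     [forall e in S, ((x1 *m A) 0 e * (x2 *m A) 0 e +
                      (x3 *m A) 0 e * (x4 *m A) 0 e == 0)%R])%N.

(* For fixed [x1] and [x3] the equations are linear in [(x2, x4)]; the solutions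
   of the transposed system are the [al] with [x1] and [x3] in the kernel of
   [pencil A al]. *)
Lemma nquadrics_pker (n N : nat) (A : 'M[F]_(n, N)) (S : {set 'I_N}) :
  (nquadrics A S * q ^ #|S| =
   q ^ (n + n) * \sum_(al | zero_on (~: S) al) pker A al ^ 2)%N.
Proof.
have q0 : (0 < q)%N by rewrite ltnW // card_finNzRing_gt1.
(* [D] brings in slack variables: those outside [S] absorb their equations, those in [S] are free
   and yield [q ^ #|S|]. In the transposed system [D] forces [al] to vanish outside [S]. *)
pose D : 'M[F]_N := diag_mx (\row_e (e \notin S)%:R).
pose M (x1 x3 : 'rV[F]_n) :=
  col_mx (col_mx (A *m diag_mx (x1 *m A)) (A *m diag_mx (x3 *m A))) D.
have sumr (w : 'rV[F]_N) : (\sum_(r : 'rV[F]_N) (w + r *m D == 0)%R =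
    [forall e in S, w 0%R e == 0%R] * q ^ #|S|)%N.
  transitivity (\prod_e \sum_t ((w 0 e + t * (e \notin S)%:R == 0)%R : nat))%N.
    rewrite -sum_row_prod; apply: eq_bigr => r _.
    rewrite -(natb_forall (fun e => w 0 e + r 0 e * (e \notin S)%:R == 0)).
    congr nat_of_bool; apply/eqP/forallP => [/rowP H e|H].
      by have := H e; rewrite mxE mul_mx_diag !mxE => ->.
    by apply/rowP => e; rewrite mxE mul_mx_diag !mxE; apply/eqP.
  transitivity (\prod_e ((e \in S) ==> (w 0 e == 0)%R) * \prod_(e in S) q)%N; last first.
    by rewrite prod_nat_const natb_forall.
  rewrite [X in (_ * X)%N]big_mkcond -big_split; apply: eq_bigr => e _ /=.
  case: (e \in S) => /=.
    under eq_bigr do rewrite mulr0 addr0.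
    by rewrite sum_nat_const mulnC.
  rewrite (bigD1 (- w 0 e)) //= mulr1 subrr eqxx big1 // => t.
  by rewrite mulr1 addrC addr_eq0 => /negPf->.
have kerM x1 x3 : (#|[set x : 'rV[F]_(n + n + N) | x *m M x1 x3 == 0%R]| = (\sum_(x2
  : 'rV[F]_n) \sum_(x4 : 'rV[F]_n)
     [forall e in S, ((x1 *m A) 0 e * (x2 *m A) 0 e +
                      (x3 *m A) 0 e * (x4 *m A) 0 e == 0)%R]) * q ^ #|S|)%N.
  rewrite -sum1_card big_mkcond /=.
  rewrite (reindex (fun p : 'rV_n * 'rV_n * 'rV_N => row_mx (row_mx p.1.1 p.1.2)
    p.2)); last first.
    exists (fun x => (lsubmx (lsubmx x), rsubmx (lsubmx x), rsubmx x)) => [[[x2 x4]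
      r]|x] _ /=.
      by rewrite !(row_mxKl, row_mxKr).
    by rewrite !hsubmxK.
  rewrite -(pair_big xpredT xpredT (fun p r => if row_mx (row_mx p.1 p.2) r
     \in [set x : 'rV[F]_(n + n + N) | x *m M x1 x3 == 0%R] then 1%N else 0%N)) /=.
  rewrite -(pair_big xpredT xpredT (fun x2 x4 => \sum_r if row_mx (row_mx x2 x4) r
     \in [set x : 'rV[F]_(n + n + N) | x *m M x1 x3 == 0%R] then 1%N else 0%N)) /=.
  rewrite big_distrl; apply: eq_bigr => x2 _; rewrite big_distrl;
    apply: eq_bigr => x4 _ /=.
  pose w := x2 *m (A *m diag_mx (x1 *m A)) + x4 *m (A *m diag_mx (x3 *m A)).
  transitivity (\sum_r ((w + r *m D == 0)%R : nat))%N.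
    by apply: eq_bigr => r _; rewrite inE !mul_row_col; case: eqP.
  rewrite sumr; congr (nat_of_bool _ * _)%N; apply: eq_forallb => e.
  by rewrite [w 0 e]mxE !mul_diag_entry [X in X + _]mulrC [X in _ + X]mulrC.
have kerMT x1 x3 : (#|[set x : 'rV[F]_N | x *m (M x1 x3)^T == 0%R]| =
    \sum_(al | zero_on (~: S) al) (x1 *m pencil A al == 0%R) * (x3 *m pencil A al ==
      0%R))%N.
  rewrite -sum1_card [LHS]big_mkcond [RHS]big_mkcond /=; apply: eq_bigr => al _;
    rewrite inE.
  rewrite !tr_col_mx !mul_mx_row !row_mx_eq0 !trmx_mul !tr_diag_mx.
  have E (x : 'rV_n) : al *m (diag_mx (x *m A) *m A^T) = x *m pencil A al.
    by rewrite /pencil !mulmxA [al *m _]mul_diagC.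
  have -> : (al *m diag_mx (\row_e (e \notin S)%:R) == 0) = zero_on (~: S) al.
    rewrite mul_mx_diag; apply/eqP/forall_inP => [/rowP H e|H].
      by rewrite inE => eS; have := H e; rewrite !mxE eS mulr1 => ->.
    apply/rowP => e; rewrite !mxE; have [eS|eS] := boolP (e \in S);
      first by rewrite mulr0.
    by rewrite (eqP (H e _)) ?mul0r // inE.
  by rewrite !E mulnb; case: (_ == 0); case: (_ == 0); case: (zero_on _ _).
have key x1 x3 := card_ker_tr (M x1 x3).
apply/eqP; rewrite -(eqn_pmul2r (_ : 0 < q ^ N)%N) ?expn_gt0 ?q0 //; apply/eqP.
transitivity (\sum_x1 \sum_x3 #|[set x : 'rV[F]_(n + n + N) | x *m M x1 x3 == 0%R]| *
  q ^ N)%N.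
  rewrite /nquadrics !big_distrl; apply: eq_bigr => x1 _ /=.
  rewrite !big_distrl; apply: eq_bigr => x3 _ /=; by rewrite kerM.
under eq_bigr => x1 _ do under eq_bigr => x3 _ do rewrite key kerMT expnD.
under eq_bigr => x1 _ do rewrite -big_distrl /=.
rewrite -big_distrl /= mulnA; congr (_ * _)%N; rewrite mulnC; congr (_ * _)%N.
under eq_bigr => x1 _ do rewrite exchange_big /=.
rewrite exchange_big /=; apply: eq_bigr => al _; rewrite -mulnn /pker big_distrlr.
by [].
Qed.

End Pencil.

(** * Comparison of counts for a pair of orthogonal complements *)

Section DualPencils.
Variable F : finFieldType.
Local Notation q := #|F|.

Definition lines_of (N : nat) (al : 'rV[F]_N) : {ffun 'I_N -> option F} :=
  [ffun e => Some (al 0 e)].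

Section Dual.
Variables (n h N : nat) (A : 'M[F]_(n, N)) (B : 'M[F]_(h, N)).
Hypotheses (freeA : row_free A) (freeB : row_free B) (orthAB : A *m B^T = 0).
Hypothesis dimN : N = (n + h)%N.

Lemma orthBA : B *m A^T = 0.
Proof. by rewrite -[B]trmxK -trmx_mul orthAB trmx0. Qed.

(** The row space of [B] lies in the orthogonal complement of that of [A], and the dimensions
    agree. *)
Lemma sub_orth (w : 'rV[F]_N) : w *m A^T = 0 -> exists v, w = v *m B.
Proof.
move=> wA; apply/submxP; have : (B <= kermx A^T)%MS by apply/sub_kermxP/orthBA.
move/mxrank_leqif_eq => [_]; rewrite mxrank_ker mxrank_tr.
rewrite (eqP freeA) (eqP freeB) [X in (X - _)%N]dimN addKn eqxx => /esym/eqmxP E.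
by rewrite E; apply/sub_kermxP.
Qed.

(** The vector u is in the kernel iff u A diag(al) is orthogonal to the rows of [A], that is, equal
    to - v B for some v, which is then unique. *)
Lemma pker_nker al : pker A al = nker A B (lines_of al).
Proof.
apply: eq_bigr => u _; pose w := u *m A *m diag_mx al.
have wE e : w 0 e = al 0 e * (u *m A) 0 e by rewrite /w mul_mx_diag mxE mulrC.
have killE v : killed A B (lines_of al) u v = (w + v *m B == 0).
  apply/forallP/eqP => [H|/rowP H e].
    apply/rowP => e; have := H e; rewrite ffunE /= -wE => /eqP E.
    by rewrite [LHS]mxE E mxE.
  by rewrite ffunE /= -wE; have := H e; rewrite mxE => ->; rewrite mxE.
under eq_bigr do rewrite killE.
have -> : u *m pencil A al = w *m A^T by rewrite /pencil !mulmxA.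
have [/eqP/sub_orth[v0 ->]|nw] := boolP (w *m A^T == 0).
  rewrite (bigD1 (- v0)) //= mulNmx subrr eqxx big1 // => v.
  rewrite -mulmxDl -(mul0mx _ B) (inj_eq (row_free_inj freeB)) addrC addr_eq0.
  by move/negPf->.
rewrite big1 // => v _; case: eqP => // /eqP; rewrite addr_eq0 => /eqP E.
by rewrite E -mulNmx -mulmxA orthBA mulmx0 eqxx in nw.
Qed.

(** Inclusion-exclusion over the set [J] of coordinates at infinity isolates the points
    [lines_of al]. *)
Lemma nreg_nondeg I :
  (nreg A I)%:Z = \sum_(J : {set 'I_N}) (-1) ^+ #|J| * (nondeg A B I J)%:Z.
Proof.
pose Q (l : {ffun 'I_N -> option F}) :=
  [forall e in I, l e == Some 0] && (nker A B l == 1%N).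
pose P (e : 'I_N) (l : {ffun 'I_N -> option F}) := l e == None.
have -> : nreg A I = #|[set l | Q l & [forall e, ~~ P e l]]|.
  rewrite -sum1_card /nreg -big_mkcondr /=.
  rewrite [RHS](reindex_onto (@lines_of N) (fun l => \row_e odflt 0 (l e))) /=;
    last first.
    move=> l; rewrite !inE => /andP[_ /forallP lN]; apply/ffunP => e.
    by rewrite ffunE mxE; have := lN e; rewrite /P; case: (l e).
  apply: eq_bigl => al; rewrite inE /Q -pker_nker.
  have -> : \row_e odflt 0 (lines_of al e) == al.
    by apply/eqP/rowP => e; rewrite mxE ffunE.
  have -> : [forall e, ~~ P e (lines_of al)] by apply/forallP => e; rewrite /P ffunE.
  rewrite !andbT; congr (_ && _); apply: eq_forallb_in => e _.
  by rewrite ffunE (inj_eq Some_inj).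
rewrite inclusion_exclusion; apply: eq_bigr => J _; congr (_ * Posz _).
rewrite -sum1_card /nondeg -big_mkcondr /=; apply: eq_bigl => l.
rewrite inE /Q andbAC; congr (_ && _); apply/andP/forallP.
  move=> [/forall_inP HI /forall_inP HJ] e.
  by apply/andP; split; apply/implyP => ?; [apply: HI|apply: HJ].
move=> H; split; apply/forall_inP => e He; case/andP: (H e).
  by rewrite He.
by rewrite He => _.
Qed.

Lemma nreg_dvd2 (I : {set 'I_N}) : (2 + #|I| <= h)%N -> (#|I| + n <= h)%N ->
  (q ^ 2 %| nreg A I)%N.
Proof.
move=> h1 h2; rewrite dvdn_dvdz nreg_nondeg.
apply: rpred_sum => J _; rewrite dvdz_mull // -dvdn_dvdz.
apply: (dvdn_nondeg2 orthAB dimN) => //.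
by apply: leq_trans h2 (leq_addr _ _).
Qed.

End Dual.

Section Middle.
Variables (n N : nat) (A B : 'M[F]_(n, N)).
Hypotheses (freeA : row_free A) (freeB : row_free B) (orthAB : A *m B^T = 0).
Hypotheses (dimN : N = (n + n)%N) (n3 : (3 <= n)%N).

Lemma nreg_mod3 : ((q ^ 3)%N %| (nreg A set0)%:Z - (nondeg A B set0 set0)%:Z)%Z.
Proof.
rewrite (nreg_nondeg freeA freeB orthAB dimN) (bigD1 set0) //= cards0 expr0 mul1r.
rewrite addrAC subrr add0r.
apply: rpred_sum => J J0; rewrite dvdz_mull // -dvdn_dvdz.
apply: (dvdn_nondeg3 orthAB dimN) => //.
by rewrite -[X in (X < _)%N]addn0 ltn_add2l card_gt0.
Qed.

Lemma nreg1_dvd2 (I : {set 'I_N}) : (#|I| <= 1)%N -> (q ^ 2 %| nreg A I)%N.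
Proof.
rewrite leq_eqVlt ltnS leqn0 => /orP[I1|/eqP I0]; last first.
  by apply: (nreg_dvd2 freeA freeB orthAB dimN); rewrite I0 ?addn0 ?add0n // ltnW.
rewrite dvdn_dvdz (nreg_nondeg freeA freeB orthAB dimN).
apply: rpred_sum => J _; rewrite dvdz_mull // -dvdn_dvdz.
(* For [J] empty the inequality needed by [dvdn_nondeg2] fails; exchanging [A] and [B] moves [I] to
   infinity instead. *)
have [->|J0] := eqVneq J set0.
  rewrite nondeg_swap.
  apply: (@dvdn_trans (q ^ 3)%N); first by apply: dvdn_exp2l.
  apply: (dvdn_nondeg3 (orthBA orthAB) dimN) => //.
  by rewrite (eqP I1) addn1.
apply: (dvdn_nondeg2 orthAB dimN); rewrite (eqP I1) //.
by rewrite addnC leq_add2l card_gt0.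
Qed.

Definition nonvanishing (m : nat) (M : 'M[F]_(m, N)) : nat :=
  #|[set x : ('rV[F]_m * 'rV[F]_m) * ('rV[F]_m * 'rV[F]_m) | [forall e,
    (x.1.1 *m M) 0 e * (x.2.1 *m M) 0 e + (x.1.2 *m M) 0 e * (x.2.2 *m M) 0 e != 0]]|.

(** With [I] the complement of [S], the count is [q ^ #|I|] times the second moment [Z] of [pker].
    For [#|I|] = 1 use [nreg1_dvd2]. For [#|I|] = 2 compare [Z] modulo q with the first moment, a
    multiple of q^(n - 2). *)
Lemma nquadrics_dvd3 S : S != [set: 'I_N] -> (q ^ 3 %| nquadrics A S)%N.
Proof.
move=> ST; have q0 : (0 < q)%N by rewrite ltnW // card_finNzRing_gt1.
set I := ~: S; set Z := (\sum_(al | zero_on I al) pker A al ^ 2)%N.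
have cS : (#|S| + #|I| = n + n)%N by rewrite cardsC card_ord -dimN.
have I0 : (0 < #|I|)%N.
  by rewrite card_gt0; apply: contra ST => /eqP E; rewrite -[S]setCK -/I E setC0.
have E : nquadrics A S = (q ^ #|I| * Z)%N.
  apply/eqP; rewrite -(eqn_pmul2r (_ : 0 < q ^ #|S|)%N) ?expn_gt0 ?q0 //.
  by rewrite nquadrics_pker -/I -/Z -cS expnD mulnAC mulnC [(q ^ #|S| * _)%N]mulnC mulnA.
rewrite E; have [C [m1 [m2 [E1 E2]]]] := sum_powers (zero_on I) (pker_pow A).
case: (ltngtP #|I| 2) => cI.
- have I1 : #|I| = 1%N by apply/eqP; rewrite eqn_leq I0 andbT -ltnS.
  by rewrite I1 expnS dvdn_mul // (dvdn2_powers E2) nreg1_dvd2 // I1.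
- by rewrite dvdn_mulr // dvdn_exp2l.
rewrite cI (expnSr q 2) dvdn_mul //.
have : (q %| \sum_(al | zero_on I al) pker A al)%N.
  apply: dvdn_trans (dvdn_sum_pker A I); rewrite -{1}[q]expn1 dvdn_exp2l //.
  by rewrite cI dimN; lia.
rewrite E1 -/(nreg A I) dvdn_addl; last by rewrite expnS -mulnA dvdn_mulr.
rewrite dvdn_addl; last by rewrite dvdn_mulr.
rewrite /Z E2 -/(nreg A I) => dq.
by rewrite dvdn_add // ?dvdn_add // expnS -?expnSr -!mulnA dvdn_mulr.
Qed.

(** The difference is q^2 C modulo q^3, with C from [sum_powers]. As q^2 divides both the first
    moment and [nreg A set0], q divides C. *)
Lemma nquadricsT_mod3 : ((q ^ 3)%N %| (nquadrics A setT)%:Z - (nreg A set0)%:Z)%Z.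
Proof.
have q0 : (0 < q)%N by rewrite ltnW // card_finNzRing_gt1.
have E : nquadrics A setT = (\sum_(al | zero_on set0 al) pker A al ^ 2)%N.
  apply/eqP; rewrite -(eqn_pmul2r (_ : 0 < q ^ #|[set: 'I_N]|)%N) ?expn_gt0 ?q0 //.
  by rewrite nquadrics_pker setCT mulnC cardsT card_ord -dimN.
have [C [m1 [m2 [E1 E2]]]] := sum_powers (zero_on set0) (pker_pow A).
rewrite E E2 -/(nreg A set0) -addnA PoszD addrAC subrr add0r.
rewrite -dvdn_dvdz dvdn_add //; last by rewrite dvdn_mulr.
rewrite (expnSr q 2) dvdn_mul //.
have : (q ^ 2 %| \sum_(al | zero_on set0 al) pker A al)%N.
  apply: dvdn_trans (dvdn_sum_pker A set0); rewrite dvdn_exp2l //.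
  by rewrite cards0 dimN; lia.
rewrite E1 -/(nreg A set0) dvdn_addl; last by rewrite dvdn_mulr.
rewrite dvdn_addr; last by rewrite nreg1_dvd2 // cards0.
by rewrite expnS expn1 dvdn_pmul2l.
Qed.

Lemma nonvanishing_mod3 : ((q ^ 3)%N %| (nonvanishing A)%:Z - (nreg A set0)%:Z)%Z.
Proof.
pose P (e : 'I_N) (x : ('rV[F]_n * 'rV[F]_n) * ('rV[F]_n * 'rV[F]_n)) :=
  (x.1.1 *m A) 0 e * (x.2.1 *m A) 0 e + (x.1.2 *m A) 0 e * (x.2.2 *m A) 0 e == 0.
have -> : nonvanishing A = #|[set x | true & [forall e, ~~ P e x]]| by [].
rewrite (inclusion_exclusion xpredT) /=.
have E (S : {set 'I_N}) : #|[set x | [forall e in S, P e x]]| = nquadrics A S.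
  rewrite -sum1_card big_mkcond /nquadrics [RHS]pair_big /=.
  under [RHS]eq_bigr => p _ do rewrite pair_big /=.
  rewrite [RHS]pair_big /=; apply: eq_bigr => x _; rewrite inE.
  by case: [forall _ in _, _].
under eq_bigr do rewrite E.
(* The full set enters with the sign [(-1) ^+ N], which is 1 because N = 2 n. *)
rewrite (bigD1 [set: 'I_N]) //= cardsT card_ord {1}dimN exprD -expr2 sqrr_sign mul1r.
rewrite addrAC rpredD ?nquadricsT_mod3 //.
apply: rpred_sum => S ST; rewrite dvdz_mull // -dvdn_dvdz.
exact: nquadrics_dvd3.
Qed.

End Middle.
End DualPencils.

(** * The Cauchy-Binet formula and unimodular minors *)

Section CauchyBinet.
Variable R : comNzRingType.

(* Squared maximal minor on the columns in [S]; it does not depend on the chosen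
   enumeration [f] of [S]. *)
Definition sqminor (n N : nat) (A : 'M[R]_(n, N)) (S : {set 'I_N}) : R :=
  if [pick f : {ffun 'I_n -> 'I_N} | injectiveb f && (f @: setT == S)] is Some f
  then \det (colsub f A) ^+ 2 else 0.

(** Expand over all maps [f] from rows to columns. A noninjective [f] gives a minor with two equal
    columns; those with image [S] are one [f0] composed with permutations, whose signs build the
    second factor of the square. *)
Lemma cauchy_binet_diag (n N : nat) (A : 'M[R]_(n, N)) (al : 'rV[R]_N) :
  \det (A *m diag_mx al *m A^T) =
  \sum_(S : {set 'I_N}) (\prod_(e in S) al 0 e) * sqminor A S.
Proof.
transitivity (\sum_(f : {ffun 'I_n -> 'I_N})
  (\prod_i al 0 (f i)) * (\prod_i A i (f i)) * \det (colsub f A)).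
  transitivity (\sum_(s : 'S_n) \sum_(f : {ffun 'I_n -> 'I_N}) (-1) ^+ s *
      ((\prod_i al 0 (f i)) * (\prod_i A i (f i)) * \prod_i A (s i) (f i))).
    apply: eq_bigr => s _; rewrite -mulr_sumr; congr (_ * _).
    under [RHS]eq_bigr do rewrite -!big_split.
    rewrite -(bigA_distr_bigA (fun i e => al 0 e * A i e * A (s i) e)) /=.
    apply: eq_bigr => i _; rewrite mxE; apply: eq_bigr => e _.
    by rewrite mul_mx_diag !mxE [al _ _ * _]mulrC.
  rewrite exchange_big; apply: eq_bigr => f _ /=.
  rewrite -det_tr mulr_sumr; apply: eq_bigr => s _; rewrite mulrCA; congr (_ * (_ * _)).
  by apply: eq_bigr => i _; rewrite !mxE.
rewrite (bigID (fun f : {ffun _ -> _} => injectiveb f)) /= [X in _ + X]big1 ?addr0;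
  last first.
  move=> f /injectivePn[i [j ij fij]].
  rewrite -det_tr (determinant_alternate ij) ?mulr0 // => k.
  by rewrite !mxE fij.
rewrite (partition_big (fun f : {ffun 'I_n -> 'I_N} => f @: setT) xpredT) //=.
apply: eq_bigr => S _; rewrite /sqminor; case: pickP => [f0|none]; last first.
  by rewrite big_pred0 ?mulr0 // => f; exact: none.
move=> /andP[/injectiveP inj0 /eqP im0].
pose h (s : 'S_n) := [ffun i => f0 (s i)].
have injh : injective h.
  by move=> s t /ffunP E; apply/permP => i; apply: inj0; have := E i; rewrite !ffunE.
transitivity (\sum_(f in h @: [set: 'S_n])
    (\prod_i al 0 (f i)) * (\prod_i A i (f i)) * \det (colsub f A)).
  apply: eq_bigl => f; apply/andP/imsetP => [[/injectiveP injf /eqP imf]|[s _ ->]].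
    have ex i : exists j, f0 j == f i.
      have : f i \in f0 @: setT by rewrite im0 -imf imset_f // inE.
      by case/imsetP => j _ ->; exists j.
    pose g i := xchoose (ex i).
    have gE i : f0 (g i) = f i by apply/eqP/(xchooseP (ex i)).
    have injg : injective g by move=> i j gij; apply: injf; rewrite -!gE gij.
    by exists (perm injg); rewrite ?inE //; apply/ffunP => i; rewrite ffunE permE gE.
  split; first by apply/injectiveP => i j; rewrite !ffunE => /inj0/perm_inj.
  rewrite -im0; apply/eqP/setP => e; apply/imsetP/imsetP => -[i _ ->].
    by exists (s i); rewrite ?inE // ffunE.
  by exists ((s^-1)%g i); rewrite ?inE // ffunE permKV.
rewrite big_imset /=; last by move=> s t _ _; apply: injh.
rewrite (eq_bigl xpredT) => [|s]; last by rewrite inE.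
have hal s : \prod_i al 0 (h s i) = \prod_(e in S) al 0 e.
  transitivity (\prod_i al 0 (f0 i)).
    rewrite [RHS](reindex_inj (@perm_inj _ s)).
    by apply: eq_bigr => i _; rewrite ffunE.
  by rewrite -im0 big_imset /=; [apply: eq_bigl => i; rewrite inE|move=> i j _ _;
    apply: inj0].
have hdet s : \det (colsub (h s) A) = (-1) ^+ s * \det (colsub f0 A).
  have -> : colsub (h s) A = col_perm s (colsub f0 A).
    by apply/matrixP => i j; rewrite !mxE ffunE.
  by rewrite col_permE det_mulmx det_perm odd_permV mulrC.
under eq_bigr do rewrite hal hdet -mulrA.
rewrite -mulr_sumr; congr (_ * _); rewrite expr2 {3}/determinant mulr_suml.
apply: eq_bigr => s _; rewrite mulrCA mulrA; congr (_ * _ * _).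
by apply: eq_bigr => i _; rewrite mxE ffunE.
Qed.

End CauchyBinet.

Lemma sqminor_map (R S : comNzRingType) (f : {rmorphism R -> S}) (n N : nat)
    (A : 'M[R]_(n, N)) (X : {set 'I_N}) :
  sqminor (map_mx f A) X = f (sqminor A X).
Proof.
rewrite /sqminor; case: pickP => [g _|_]; last by rewrite rmorph0.
by rewrite -map_mxsub det_map_mx rmorphXn.
Qed.

Lemma sqminor_eq1 (n N : nat) (A : 'M[int]_(n, N)) (S : {set 'I_N}) :
  #|S| = n ->
  (forall f : {ffun 'I_n -> 'I_N}, injective f -> f @: setT = S ->
     exists C : 'M_n, C *m colsub f A = 1%:M) ->
  sqminor A S = 1.
Proof.
move=> cS HS; rewrite /sqminor; case: pickP => [f|none].
  move=> /andP[/injectiveP injf /eqP imf]; have [C CA] := HS f injf imf.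
  have : \det C * \det (colsub f A) = 1 by rewrite -det_mulmx CA det1.
  move: (\det C) (\det (colsub f A)) => x y /(congr1 absz); rewrite abszM => /eqP.
  rewrite muln_eq1 => /andP[_ /eqP y1]; move: y1.
  by case: y => [[|[|?]]|[|?]].
pose f := [ffun i : 'I_n => enum_val (cast_ord (esym cS) i)].
have := none f; case/andP; split.
  apply/injectiveP => i j; rewrite !ffunE => /enum_val_inj; exact: cast_ord_inj.
apply/eqP/setP => e; apply/imsetP/idP => [[i _ ->]|eS].
  by rewrite ffunE enum_valP.
exists (cast_ord cS (enum_rank_in eS e)); rewrite ?inE // ffunE.
by rewrite cast_ordK enum_rankK_in.
Qed.

Lemma sqminor_eq0 (n N : nat) (A : 'M[int]_(n, N)) (S : {set 'I_N}) :
  (forall f : {ffun 'I_n -> 'I_N}, injective f -> f @: setT = S ->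
     \det (colsub f A) = 0) ->
  sqminor A S = 0.
Proof.
move=> HS; rewrite /sqminor; case: pickP => // f /andP[/injectiveP injf /eqP imf].
by rewrite HS // expr0n.
Qed.

(** * Incidence matrix, cycle basis and spanning trees *)

Section GraphMatrices.
Variable G : graph.
Local Notation n := (nG G).
Local Notation N := (NG G).
Implicit Types (T S : {set 'I_N}) (e : 'I_N) (c : 'rV[int]_N).

(** The vertex left out is the one that [xvec] puts at the origin. *)
Definition incidence : 'M[int]_(n, N) :=
  \matrix_(p, e) boundary G e (lift ord_max p).

Definition extend (R : nzRingType) (m : nat) (y : 'rV[R]_m) (v : 'I_m.+1) : R :=
  if unlift ord_max v is Some p then y 0 p else 0.

Lemma sum_extend (R : nzRingType) (m : nat) (y : 'rV[R]_m) (v : 'I_m.+1) :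
  \sum_p y 0 p * (lift ord_max p == v)%:R = extend y v.
Proof.
rewrite /extend; case: unliftP => [j|] ->.
  rewrite (bigD1 j) //= eqxx mulr1 big1 ?addr0 // => i ij.
  by rewrite (inj_eq lift_inj) (negPf ij) mulr0.
by rewrite big1 // => i _; rewrite eq_sym (negPf (neq_lift _ _)) mulr0.
Qed.

Lemma mul_incidence (R : nzRingType) (y : 'rV[R]_n) e :
  (y *m map_mx intr incidence) 0 e = extend y (tgt e) - extend y (src e).
Proof.
rewrite mxE -!sum_extend -sumrB; apply: eq_bigr => p _.
by rewrite !mxE rmorphB /= !rmorph_nat mulrBr.
Qed.

Lemma mul_incidenceZ (y : 'rV[int]_n) e :
  (y *m incidence) 0 e = extend y (tgt e) - extend y (src e).
Proof.
rewrite -mul_incidence; congr ((_ *m _) _ _).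
by apply/matrixP => i j; rewrite !mxE intz.
Qed.

Lemma adj_sym T : ssrbool.symmetric (adj T).
Proof. by move=> u v; apply: eq_existsb => e; rewrite orbC. Qed.

Lemma connectC T u v : connect (adj T) u v = connect (adj T) v u.
Proof. exact: sym_connect_sym (@adj_sym T) u v. Qed.

Lemma connect_edge T e w : e \in T ->
  connect (adj T) w (src e) = connect (adj T) w (tgt e).
Proof.
move=> eT; have st : connect (adj T) (src e) (tgt e).
  by apply: connect1; apply/exists_inP; exists e; rewrite // !eqxx.
apply/idP/idP => H; first exact: connect_trans H st.
by apply: connect_trans H _; rewrite connectC.
Qed.

Definition supported T c := forall e, e \notin T -> c 0 e = 0.

Lemma edge_boundary e :
  delta_mx (0 : 'I_1) e *m boundary G = delta_mx 0 (tgt e) - delta_mx 0 (src e).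
Proof. by rewrite -rowE; apply/rowP => v; rewrite !mxE eqxx. Qed.

Lemma connect_chain T u v : connect (adj T) u v ->
  exists2 c, supported T c & c *m boundary G = delta_mx 0 v - delta_mx 0 u.
Proof.
case/connectP=> p; elim: p u => [|w p IHp] u /=.
  by move=> _ ->; exists 0 => [e _|]; rewrite ?mul0mx ?subrr ?mxE.
move=> /andP[/exists_inP[e eT uw] pw] lv; have [c cT cb] := IHp w pw lv.
have dT : supported T (delta_mx 0 e).
  by move=> e' e'T; rewrite mxE eqxx /=; case: eqP e'T => // ->; rewrite eT.
case/orP: uw => /andP[/eqP se /eqP te].
  exists (c + delta_mx 0 e) => [e' e'T|]; first by rewrite mxE cT ?dT ?addr0.
  by rewrite mulmxDl cb edge_boundary se te addrA subrK.
exists (c - delta_mx 0 e) => [e' e'T|]; first by rewrite mxE cT // mxE dT // subrr.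
by rewrite mulmxBl cb edge_boundary se te opprB addrA subrK.
Qed.

Lemma cycle_of_connect T e : connect (adj T) (src e) (tgt e) -> e \notin T ->
  exists c, [/\ supported (e |: T) c, c 0 e = 1 & c *m boundary G = 0].
Proof.
move=> /connect_chain[c cT cb] eT; exists (delta_mx 0 e - c); split.
- move=> e'; rewrite !inE negb_or => /andP[ne e'T].
  by rewrite !mxE cT // (negPf ne) andbF subr0.
- by rewrite !mxE !eqxx cT // subr0.
- by rewrite mulmxBl cb edge_boundary subrr.
Qed.

Lemma boundary_incidence c : c *m boundary G = 0 -> incidence *m c^T = 0.
Proof.
move=> cb; apply/colP => p; have /rowP/(_ (lift ord_max p)) := cb.
rewrite mxE [RHS]mxE => E; rewrite mxE [RHS]mxE -[RHS]E.
by apply: eq_bigr => e _; rewrite [incidence _ _]mxE [c^T _ _]mxE mulrC.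
Qed.

(** Without [f i] its two ends are separated in [T]. The indicator of the component of [tgt (f i)],
    shifted to be 0 at [ord_max], is a potential with difference 1 along [f i] and 0 along the other
    edges of [T]. *)
Lemma acyclic_left_inverse T (k : nat) (f : 'I_k -> 'I_N) :
  acyclic T -> injective f -> (forall i, f i \in T) ->
  exists C : 'M[int]_(k, n), C *m colsub f incidence = 1%:M.
Proof.
move=> /forall_inP acT injf fT.
pose y i v : int := (connect (adj (T :\ f i)) (tgt (f i)) v)%:R.
pose Y i : 'rV[int]_n := \row_p (y i (lift ord_max p) - y i ord_max).
have YE i v : extend (Y i) v = y i v - y i ord_max.
  by rewrite /extend; case: unliftP => [p|] ->; rewrite ?mxE ?subrr.
exists (\matrix_i Y i); apply/matrixP => i j.
have -> : ((\matrix_i Y i) *m colsub f incidence) i j = (Y i *m incidence) 0 (f j).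
  by rewrite !mxE; apply: eq_bigr => p _; rewrite !mxE.
rewrite mul_incidenceZ !YE opprB addrA subrK [RHS]mxE /y.
have [->|ij] := eqVneq i j.
  by rewrite connect0 connectC (negPf (acT _ (fT j))) subr0.
rewrite (connect_edge (e := f j)) ?subrr //.
by rewrite !inE fT andbT (inj_eq injf) eq_sym.
Qed.

Lemma sum_supported (k : nat) (f : 'I_k -> 'I_N) T c (g : 'I_N -> int) :
  injective f -> (forall e, e \in T -> exists i, f i = e) -> supported T c ->
  \sum_i g (f i) * c 0 (f i) = \sum_e g e * c 0 e.
Proof.
move=> injf fT cT.
rewrite [RHS](bigID (mem (f @: setT))) /= [X in _ + X]big1 ?addr0 => [|e].
  rewrite big_imset /=; last by move=> i j _ _; apply: injf.
  by apply: eq_bigl => i; rewrite inE.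
move=> ne; rewrite cT ?mulr0 //; apply: contra ne => /fT[i <-].
by rewrite imset_f // inE.
Qed.

(** The columns of the inverse are chains in [T] from [ord_max] to the other vertices. *)
Lemma connected_right_inverse T (k : nat) (f : 'I_k -> 'I_N) :
  connected_by T -> injective f -> (forall e, e \in T -> exists i, f i = e) ->
  exists C : 'M[int]_(k, n), colsub f incidence *m C = 1%:M.
Proof.
move=> /forallP cT injf fT.
have chain (p : 'I_n) : exists c, supported T c /\
    c *m boundary G = delta_mx 0 (lift ord_max p) - delta_mx 0 ord_max.
  have /forallP/(_ (lift ord_max p))/connect_chain[c] := cT ord_max.
  by exists c.
have [C HC] := fin_all_exists chain.
exists (\matrix_(i, p) C p 0 (f i)); apply/matrixP => p p'.
have [sC bC] := HC p'.
have E : \sum_e boundary G e (lift ord_max p) * C p' 0 e = (p == p')%:R.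
  have : (C p' *m boundary G) 0 (lift ord_max p) = (p == p')%:R.
    rewrite bC !mxE !eqxx /= (inj_eq lift_inj) [_ == ord_max]eq_sym.
    by rewrite (negPf (neq_lift _ _)) subr0.
  by rewrite mxE => <-; apply: eq_bigr => e _; rewrite mulrC.
rewrite [LHS]mxE [RHS]mxE -E -(sum_supported (boundary G ^~ (lift ord_max p)) injf fT sC).
by apply: eq_bigr => i _; congr (_ * _); rewrite [LHS]mxE // [LHS]mxE.
Qed.

Lemma spanning_tree_card T : spanning_tree T -> #|T| = n.
Proof.
move=> /andP[cT aT]; apply/eqP; rewrite eqn_leq.
have fT (i : 'I_#|T|) : enum_val i \in T by exact: enum_valP.
have [C /mulmx1_min ->] := acyclic_left_inverse aT (@enum_val_inj _ T) fT.
have [|D /mulmx1_min -> //] := connected_right_inverse cT (@enum_val_inj _ T).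
by move=> e eT; exists (enum_rank_in eT e); rewrite enum_rankK_in.
Qed.

(** Take the indicator of a component that avoids [ord_max]. *)
Lemma disconnected_kernel T : ~~ connected_by T ->
  exists2 y : 'rV[int]_n, y != 0 & forall e, e \in T -> (y *m incidence) 0 e = 0.
Proof.
rewrite negb_forall => /existsP[u]; rewrite negb_forall => /existsP[v nuv].
have [w nw] : exists w, ~~ connect (adj T) w ord_max.
  have [cu|] := boolP (connect (adj T) u ord_max); last by exists u.
  by exists v; apply: contra nuv => cv; apply: connect_trans cu _; rewrite connectC.
pose y : 'rV[int]_n := \row_p (connect (adj T) w (lift ord_max p))%:R.
have yE x : extend y x = (connect (adj T) w x)%:R.
  by rewrite /extend; case: unliftP => [p|] ->; rewrite ?mxE // (negPf nw).
exists y => [|e eT]; last by rewrite mul_incidenceZ !yE (connect_edge w eT) subrr.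
apply: contraNneq nw => y0; have := yE w; rewrite connect0 y0 /extend.
by case: unliftP => [p|] _; rewrite ?mxE.
Qed.

(** If [S] is disconnected, a potential lies in the left kernel; otherwise a cycle in [S] lies in
    the right kernel. *)
Lemma det_incidence0 S (f : {ffun 'I_n -> 'I_N}) :
  injective f -> f @: setT = S -> ~~ spanning_tree S ->
  \det (colsub f incidence) = 0.
Proof.
move=> injf imf nsT; apply/eqP.
have fS i : f i \in S by rewrite -imf imset_f // inE.
move: nsT; rewrite negb_and => /orP[/disconnected_kernel[y y0 yS]|].
  apply/det0P; exists y => //; apply/rowP => i; rewrite [RHS]mxE -(yS _ (fS i)) !mxE.
  by apply: eq_bigr => p _; rewrite !mxE.
rewrite negb_forall_in => /exists_inP[e eS]; rewrite negbK => /cycle_of_connect.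
rewrite !inE eqxx => /(_ isT)[c [cS ce cb]]; rewrite setD1K // in cS.
have fS' e' : e' \in S -> exists i, f i = e'.
  by rewrite -imf => /imsetP[i _ ->]; exists i.
rewrite -det_tr; apply/det0P; exists (\row_i c 0 (f i)).
  have [i fi] := fS' e eS; apply/eqP => /rowP/(_ i); rewrite !mxE fi ce => /eqP.
  by rewrite oner_eq0.
apply/rowP => p; have /colP/(_ p) := boundary_incidence cb; rewrite [RHS]mxE => E.
rewrite [RHS]mxE -[RHS]E !mxE; under [RHS]eq_bigr do rewrite [c^T _ _]mxE.
rewrite -(sum_supported _ injf fS' cS).
by apply: eq_bigr => i _; rewrite !mxE mulrC.
Qed.

Lemma sqminor_incidence S : sqminor incidence S = (spanning_tree S)%:R.
Proof.
have [sT|nsT] := boolP (spanning_tree S).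
  apply: sqminor_eq1 => [|f injf imf]; first exact: spanning_tree_card.
  case/andP: sT => _ aT; apply: (acyclic_left_inverse aT injf) => i.
  by rewrite -imf imset_f // inE.
by apply: sqminor_eq0 => f injf imf; apply: det_incidence0 imf nsT.
Qed.

Section CycleBasis.
Variable gamma : 'M[int]_(hG G, N).
Hypotheses (gammaP : H1_basis gamma) (dimN : N = (n + hG G)%N).

(** Close [f i] by a chain in [T]. The coordinates of this cycle in the basis form row i of the
    inverse, since among the [f j] it meets only [f i]. *)
Lemma cycle_basis_left_inverse T (f : 'I_(hG G) -> 'I_N) :
  connected_by T -> injective f -> (forall i, f i \notin T) ->
  exists C : 'M[int]_(hG G), C *m colsub f gamma = 1%:M.
Proof.
move=> /forallP cT injf fT; have [_ gen] := gammaP.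
have row_ex i : exists a : 'rV[int]_(hG G), forall j, (a *m gamma) 0 (f j) = (i == j)%:R.
  have /forallP/(_ (tgt (f i)))/connect_chain[c cS cb] := cT (src (f i)).
  have [|a [aE _]] := gen (delta_mx 0 (f i) - c).
    by rewrite mulmxBl cb edge_boundary subrr.
  exists a => j; rewrite -aE !mxE cS ?fT // subr0 eqxx (inj_eq injf).
  by rewrite eq_sym.
have [a aE] := fin_all_exists row_ex.
exists (\matrix_i a i); apply/matrixP => i j; rewrite [RHS]mxE -aE !mxE.
by apply: eq_bigr => k _; rewrite !mxE.
Qed.

Lemma sqminor_cycles S : sqminor gamma S = (spanning_tree (~: S))%:R.
Proof.
have [sT|nsT] := boolP (spanning_tree (~: S)).
  apply: sqminor_eq1 => [|f injf imf].
    have := spanning_tree_card sT; have := cardsC S; rewrite card_ord.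
    by move: #|S| #|~: S| dimN => a b ? ? ?; lia.
  case/andP: sT => cT _; apply: (cycle_basis_left_inverse cT injf) => i.
  by rewrite inE negbK -imf imset_f // inE.
apply: sqminor_eq0 => f injf imf; apply/eqP.
have fS i : f i \in S by rewrite -imf imset_f // inE.
move: nsT; rewrite negb_and; have [aT|naT] := boolP (acyclic (~: S)); last first.
  (* A cycle in the complement of [S] is a combination of basis cycles that vanishes on [S]; its
     coefficients lie in the left kernel of the minor. *)
  move=> _; move: naT; rewrite negb_forall_in => /exists_inP[e eT].
  rewrite negbK => /cycle_of_connect; rewrite !inE eqxx => /(_ isT)[c [cT ce cb]].
  rewrite setD1K // in cT; have [_ /(_ c cb)[a [aE _]]] := gammaP.
  apply/det0P; exists a.
    by apply: contra_eq_neq ce => a0; rewrite aE a0 mul0mx mxE eq_sym oner_eq0.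
  apply/rowP => i; rewrite [RHS]mxE -(cT (f i)) ?inE ?negbK // aE !mxE.
  by apply: eq_bigr => k _; rewrite !mxE.
(* This case is contradictory: the complement is acyclic with n edges, so its incidence minor is
   invertible and kills no nonzero [y]. *)
rewrite orbF => /disconnected_kernel[y y0 yT].
have cT : #|~: S| = n.
  have cS : #|S| = hG G by rewrite -imf card_imset // cardsT card_ord.
  have := cardsC S; rewrite card_ord cS.
  by move: #|~: S| dimN => b ? ?; lia.
pose g (i : 'I_n) := enum_val (cast_ord (esym cT) i).
have injg : injective g by move=> i j /enum_val_inj/cast_ord_inj.
have gT i : g i \in ~: S by exact: enum_valP.
have [C /mulmx1C AC] := acyclic_left_inverse aT injg gT.
case/negP: y0; rewrite -[y]mulmx1 -AC mulmxA (_ : y *m _ = 0) ?mul0mx //.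
apply/rowP => i; rewrite [RHS]mxE -(yT _ (gT i)) !mxE.
by apply: eq_bigr => p _; rewrite !mxE.
Qed.

End CycleBasis.
End GraphMatrices.

(** * From zero counts to counts for the pencil *)

Section Counts.
Variable F : finFieldType.
Local Notation q := #|F|.

(** For the third congruence, both numbers are compared with [nondeg A B set0 set0], symmetric by
    [nondeg_swap]. *)
Lemma pencil_counts_mod3 (n h N : nat) (A : 'M[F]_(n, N)) (B : 'M[F]_(h, N)) :
  row_free A -> row_free B -> A *m B^T = 0 -> h = n -> N = (n + n)%N ->
  (3 <= n)%N ->
  [/\ ((q ^ 3)%N %| (nonvanishing A)%:Z - (nreg A set0)%:Z)%Z,
      ((q ^ 3)%N %| (nonvanishing B)%:Z - (nreg B set0)%:Z)%Z &
      ((q ^ 3)%N %| (nreg A set0)%:Z - (nreg B set0)%:Z)%Z].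
Proof.
move=> freeA freeB orthAB hn dimN n3; subst h; have oBA := orthBA orthAB.
split; [exact: nonvanishing_mod3 orthAB _ _|exact: nonvanishing_mod3 oBA _ _|].
have := nreg_mod3 freeB freeA oBA dimN n3; rewrite nondeg_swap => dB.
have dA := nreg_mod3 freeA freeB orthAB dimN n3.
by have := rpredB dA dB; rewrite opprB addrA subrK.
Qed.

Lemma pker_eq1 (n N : nat) (A : 'M[F]_(n, N)) al :
  (pker A al == 1%N) = (\det (pencil A al) != 0).
Proof.
rewrite pker_rank -[X in _ == X](expn0 q) eqn_exp2l ?card_finNzRing_gt1 //.
by rewrite subn_eq0 row_leq_rank row_free_unit unitmxE unitfE.
Qed.

Lemma nzeros_pencil (n N : nat) (A : 'M[F]_(n, N)) (f : {mpoly int[N]}) :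
  (forall a : {ffun 'I_N -> F},
     (map_mpoly intr f).@[a] = \det (pencil A (\row_e a e))) ->
  (nzeros f F + nreg A set0 = q ^ N)%N.
Proof.
move=> fE; rewrite /nzeros; set Z := finset _.
suff -> : nreg A set0 = #|~: Z| by rewrite cardsC card_ffun card_ord.
rewrite -sum1_card /nreg (reindex _ (onW_bij _ (row_ffun_bij F N))) /=.
rewrite [LHS]big_mkcond [RHS]big_mkcond; apply: eq_bigr => a _.
rewrite !inE fE pker_eq1 (_ : zero_on _ _ = true); first by case: eqP.
by apply/forall_inP => e; rewrite inE.
Qed.

Lemma c2_of_eq (m m' : nat) (f : {mpoly int[m]}) (g : {mpoly int[m']}) :
  nzeros f F = nzeros g F %[mod q ^ 3] -> c2_of f F = c2_of g F.
Proof.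
move=> E; rewrite /c2_of; have q1 : (1 < q)%N := card_finNzRing_gt1 F.
have Em x : ((x %/ q ^ 2) %% q = x %% q ^ 3 %/ q ^ 2)%N.
  by rewrite modn_divl -expnS.
by rewrite -(Zp_nat_mod q1) -[RHS](Zp_nat_mod q1) !Em E.
Qed.

Lemma complement_mod3 (x y a b k l : nat) :
  (x + a = q ^ k)%N -> (y + b = q ^ l)%N -> (3 <= k)%N -> (3 <= l)%N ->
  ((q ^ 3)%N %| a%:Z - b%:Z)%Z -> x = y %[mod q ^ 3].
Proof.
move=> xa yb k3 l3 dab; apply/eqP; rewrite eqn_mod_dvdz.
have dk j : (3 <= j)%N -> ((q ^ 3)%N %| (q ^ j)%N%:Z)%Z.
  by move=> j3; rewrite -dvdn_dvdz dvdn_exp2l.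
have -> : x%:Z - y%:Z = (q ^ k)%N%:Z - (q ^ l)%N%:Z - (a%:Z - b%:Z).
  by rewrite -xa -yb !PoszD; ring.
by apply: rpredB dab; apply: rpredB; apply: dk.
Qed.

Definition coordinate (m : nat) (a : {ffun 'I_(m * 4) -> F}) (j : 'I_4) : 'rV[F]_m :=
  \row_p a (mxvec_index p j).

Lemma nzeros_quadrics (m N : nat) (M : 'M[F]_(m, N)) (Q : 'I_N -> {mpoly int[m * 4]}) :
  (forall (a : {ffun 'I_(m * 4) -> F}) e, (map_mpoly intr (Q e)).@[a] =
     (coordinate a (inord 0) *m M) 0 e * (coordinate a (inord 1) *m M) 0 e +
     (coordinate a (inord 2) *m M) 0 e * (coordinate a (inord 3) *m M) 0 e) ->
  (nzeros (\prod_e Q e) F + nonvanishing M = q ^ (m * 4))%N.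
Proof.
move=> QE.
(* [nonvanishing] takes the coordinates in the order ((x^1, x^3), (x^2, x^4)). *)
pose g (a : {ffun 'I_(m * 4) -> F}) := ((coordinate a (inord 0), coordinate a (inord 2)),
  (coordinate a (inord 1), coordinate a (inord 3))).
have bijg : bijective g.
  apply: inj_card_bij => [a b [/rowP E0 /rowP E2 /rowP E1 /rowP E3]|].
    apply/ffunP => k; case/mxvec_indexP: k => p j.
    have jE : j = inord j by rewrite inord_val.
    rewrite jE; case: j jE => -[|[|[|[|//]]]] /= _ _.
    - by have := E0 p; rewrite !mxE.
    - by have := E1 p; rewrite !mxE.
    - by have := E2 p; rewrite !mxE.
    - by have := E3 p; rewrite !mxE.
  by rewrite !card_prod !card_mx card_ffun card_ord -!expnD; apply: eq_leq;
    congr (_ ^ _)%N; lia.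
rewrite /nzeros; set Z := finset _.
suff -> : nonvanishing M = #|~: Z| by rewrite cardsC card_ffun card_ord.
rewrite /nonvanishing -!sum1_card (reindex g (onW_bij _ bijg)) /=; apply: eq_bigl => a.
rewrite !inE !rmorph_prod /= prodf_seq_eq0.
transitivity ([forall e, (map_mpoly intr (Q e)).@[a] != 0]).
  by apply: eq_forallb => e; rewrite QE.
rewrite -[RHS]all_predC; apply/forallP/allP => [H e _ /=|H e]; first by have := H e.
by apply: (H e); rewrite mem_index_enum.
Qed.

End Counts.

(** * Graph polynomials and propagators in terms of the two matrices *)

Section GraphCounts.
Variables (G : graph) (F : finFieldType).
Local Notation n := (nG G).
Local Notation N := (NG G).

Lemma phi_pencil (a : {ffun 'I_N -> F}) :
  (map_mpoly intr (phi G)).@[a] =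
  \det (pencil (map_mx intr (incidence G)) (\row_e a e)).
Proof.
rewrite cauchy_binet_diag /phi (rmorph_sum (map_mpoly intr)) rmorph_sum /=
  [LHS]big_mkcond; apply: eq_bigr => T _.
rewrite sqminor_map sqminor_incidence; case: (spanning_tree T); last first.
  by rewrite mulr0.
rewrite mulr1 (rmorph_prod (map_mpoly intr)) rmorph_prod; apply: eq_bigr => e _.
by rewrite /= map_mpolyX mevalXU mxE.
Qed.

Section Cycles.
Variable gamma : 'M[int]_(hG G, N).
Hypotheses (gammaP : H1_basis gamma) (dimN : N = (n + hG G)%N).

Lemma Psi_pencil (a : {ffun 'I_N -> F}) :
  (map_mpoly intr (Psi G)).@[a] = \det (pencil (map_mx intr gamma) (\row_e a e)).
Proof.
rewrite cauchy_binet_diag /Psi (rmorph_sum (map_mpoly intr)) rmorph_sum /=.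
rewrite [LHS]big_mkcond [LHS](reindex_inj (@setC_inj _)).
apply: eq_bigr => S _ /=.
rewrite sqminor_map (sqminor_cycles gammaP dimN); case: (spanning_tree _); last first.
  by rewrite mulr0.
rewrite mulr1 setCK (rmorph_prod (map_mpoly intr)) rmorph_prod; apply: eq_bigr => e _.
by rewrite /= map_mpolyX mevalXU mxE.
Qed.

Lemma row_free_incidence : connected_graph G ->
  row_free (map_mx intr (incidence G) : 'M[F]_(n, N)).
Proof.
move=> cG; have [|C CE] := connected_right_inverse cG (f := id) (fun _ _ E => E).
  by move=> e _; exists e.
apply/row_freeP; exists (map_mx intr C); rewrite -map_mxM.
by rewrite -[incidence G]mxsub_id CE map_mx1.
Qed.

(** A nonzero maximal minor of the incidence matrix over [F] provides a spanning tree; the minor of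
    [gamma] on its complement is invertible over the integers, hence over [F]. *)
Lemma row_free_cycles : connected_graph G ->
  row_free (map_mx intr gamma : 'M[F]_(hG G, N)).
Proof.
move=> /row_free_incidence freeA.
have fullA : row_full (map_mx intr (incidence G) : 'M[F]_(n, N))^T.
  by rewrite /row_full mxrank_tr.
pose f := fullrankfun fullA.
have sT : spanning_tree (f @: setT).
  have := fullrowsub_unit fullA; rewrite unitmxE unitfE; apply: contraNT => nsT.
  rewrite -det_tr trmx_mxsub trmxK -map_mxsub det_map_mx.
  by rewrite (det_incidence0 _ erefl nsT) ?rmorph0 //; apply: fullrankfun_inj.
have cS : #|~: (f @: setT)| = hG G.
  have := spanning_tree_card sT; have := cardsC (f @: setT); rewrite card_ord.
  by move: #|f @: setT| #|~: (f @: setT)| dimN => a b ? ? ?; lia.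
pose g (i : 'I_(hG G)) := enum_val (cast_ord (esym cS) i).
have injg : injective g by move=> i j /enum_val_inj/cast_ord_inj.
have gT i : g i \notin f @: setT by rewrite -in_setC; exact: enum_valP.
have /andP[cT _] := sT.
have [C /mulmx1C CE] := cycle_basis_left_inverse gammaP cT injg gT.
apply/row_freeP; exists (colsub g 1%:M *m map_mx intr C).
by rewrite mulmxA mulmx_colsub mulmx1 -map_mxsub -map_mxM CE map_mx1.
Qed.

Lemma orth_incidence_cycles :
  (map_mx intr (incidence G) : 'M[F]_(n, N)) *m (map_mx intr gamma)^T = 0.
Proof.
rewrite map_trmx -map_mxM; have [gb _] := gammaP.
suff -> : incidence G *m gamma^T = 0 by rewrite map_mx0.
apply/matrixP => p j; have := boundary_incidence (c := row j gamma).
rewrite -row_mul gb row0 => /(_ erefl)/colP/(_ p); rewrite !mxE => E.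
by rewrite -[RHS]E; apply: eq_bigr => e _; rewrite !mxE.
Qed.

Lemma mom_eval (a : {ffun 'I_(hG G * 4) -> F}) e :
  (map_mpoly intr (mom_Q gamma e)).@[a] =
  (coordinate a (inord 0) *m map_mx intr gamma) 0 e *
  (coordinate a (inord 1) *m map_mx intr gamma) 0 e +
  (coordinate a (inord 2) *m map_mx intr gamma) 0 e *
  (coordinate a (inord 3) *m map_mx intr gamma) 0 e.
Proof.
have E i : (map_mpoly intr ((\sum_(j < hG G) vec4 j *~ gamma j e) 0 i)).@[a] =
    (coordinate a i *m map_mx intr gamma) 0 e.
  rewrite summxE (rmorph_sum (map_mpoly intr)) rmorph_sum mxE; apply: eq_bigr => j _.
  have -> : (vec4 j *~ gamma j e) 0 i = vec4 j 0 i *~ gamma j e.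
    case: (gamma j e) => k; first by rewrite -!pmulrn mulmxnE.
    by rewrite NegzE !mulrNz -!pmulrn mxE mulmxnE.
  by rewrite !rmorphMz /= !mxE map_mpolyX mevalXU mulrzr.
by rewrite /mom_Q /norm4 !rmorphD !rmorphM /= !E.
Qed.

End Cycles.

Lemma pos_eval (a : {ffun 'I_(n * 4) -> F}) e :
  (map_mpoly intr (pos_q e)).@[a] =
  (coordinate a (inord 0) *m map_mx intr (incidence G)) 0 e *
  (coordinate a (inord 1) *m map_mx intr (incidence G)) 0 e +
  (coordinate a (inord 2) *m map_mx intr (incidence G)) 0 e *
  (coordinate a (inord 3) *m map_mx intr (incidence G)) 0 e.
Proof.
have Ex v i : (map_mpoly intr (xvec v 0 i)).@[a] = extend (coordinate a i) v.
  rewrite /xvec /extend; case: (unlift ord_max v) => [p|].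
    by rewrite !mxE map_mpolyX mevalXU.
  by rewrite mxE !rmorph0.
(* The opposite orientation conventions give a sign, which cancels in the products. *)
have E i : (map_mpoly intr ((xvec (src e) - xvec (tgt e)) 0 i)).@[a] =
    - (coordinate a i *m map_mx intr (incidence G)) 0 e.
  by rewrite mxE [X in _ + X]mxE !rmorphB /= !Ex mul_incidence opprB.
by rewrite /pos_q /norm4 !rmorphD !rmorphM /= !E !mulrNN.
Qed.

End GraphCounts.

Theorem theorem6 (G : graph) (Gconn : connected_graph G)
  (Gadm : duality_admissible G) (hG3 : (3 <= hG G)%N) (nG3 : (3 <= nG G)%N)
  (gamma : 'M[int]_(hG G, NG G)) (gammaP : H1_basis gamma)
  (F : finFieldType) :
  [/\ c2 G F = c2_mom gamma F,
      c2_mom gamma F = c2_dual G F &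
      c2_dual G F = c2_pos G F].
Proof.
have [logdiv _ _ _] := Gadm; rewrite /log_divergent in logdiv.
(* [hG] is a truncated difference, which [hG3] makes a true one. *)
have NE : NG G = (nG G + hG G)%N by rewrite /hG in hG3 *; lia.
have hn : hG G = nG G by rewrite /hG in hG3 logdiv *; lia.
have dimN : NG G = (nG G + nG G)%N by rewrite -{2}hn.
pose A : 'M[F]_(nG G, NG G) := map_mx intr (incidence G).
pose B : 'M[F]_(hG G, NG G) := map_mx intr gamma.
have freeA : row_free A := row_free_incidence F Gconn.
have freeB : row_free B := row_free_cycles F gammaP NE Gconn.
have orthAB : A *m B^T = 0 := orth_incidence_cycles F gammaP.
have [posE momE dualE] := pencil_counts_mod3 freeA freeB orthAB hn dimN nG3.
have zphi := nzeros_pencil (@phi_pencil G F).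
have zPsi := nzeros_pencil (Psi_pencil (F := F) gammaP NE).
have zpos := nzeros_quadrics (@pos_eval G F).
have zmom := nzeros_quadrics (@mom_eval G F gamma).
have N3 : (3 <= NG G)%N by lia.
have n43 : (3 <= nG G * 4)%N by lia.
have h43 : (3 <= hG G * 4)%N by lia.
have momPsi := c2_of_eq (complement_mod3 zmom zPsi h43 N3 momE).
have phiPsi := c2_of_eq (complement_mod3 zphi zPsi N3 N3 dualE).
have posphi := c2_of_eq (complement_mod3 zpos zphi n43 N3 posE).
rewrite /c2 /c2_mom /c2_dual /c2_pos; split; first by rewrite momPsi.
  by rewrite momPsi phiPsi.
by rewrite posphi.
Qed.
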